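(* Let $\mathcal{L}$ be a real Hilbert space, let $(\Omega,\Sigma,\mathbb{P},\Phi)$ be a Gaussian field indexed by $\mathcal{L}$, and let $\mathcal{H}_1=L^2(\Omega,\mathbb{P})$ and $\mathcal{H}_2=L^2(\Omega,\mathbb{P})\otimes\mathcal{L}$. Let $T:\operatorname{dom}T\subseteq\mathcal{H}_1\to\mathcal{H}_2$ be the Malliavin derivative and $S:\operatorname{dom}S\subseteq\mathcal{H}_2\to\mathcal{H}_1$ the stochastic integral operator. Then $T$ and $S$ form a symmetric pair: $$\langle T(F), G\otimes k\rangle_{\mathcal{H}_2}=\langle F, S(G\otimes k)\rangle_{\mathcal{H}_1},\qquad\text{for any } F,G\in\operatorname{dom}T,\ k\in\mathcal{L}.$$ Consequently, $T$ and $S$ are closable linear operators. Furthermore, $(T,S)$ is a maximal symmetric pair, whence $T^\star=\overline{S}$ and $S^\star=\overline{T}$.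
   Context: A Gaussian field indexed by the real Hilbert space $\mathcal{L}$ is a probability space $(\Omega,\Sigma,\mathbb{P})$ with a map $\Phi:\mathcal{L}\to L^2(\Omega,\mathbb{P})$ (real-valued functions) such that $\mathbb{E}[\Phi(h)]=0$ for all $h\in\mathcal{L}$ and, for every finite subset $\{h_1,\dots,h_n\}\subseteq\mathcal{L}$, the random variables $\Phi(h_1),\dots,\Phi(h_n)$ are jointly Gaussian with covariance matrix the Gramian $(\langle h_i,h_j\rangle_{\mathcal{L}})_{i,j}$. $\mathcal{H}_2=L^2(\Omega,\mathbb{P})\otimes\mathcal{L}$ is the Hilbert space tensor product, identified with the square-integrable $\mathcal{L}$-valued random variables. Malliavin derivative: $\operatorname{dom}T$ is the span of all random variables $F=p(\Phi(h_1),\dots,\Phi(h_n))$ with $n\in\mathbb{N}$, $p\in\mathbb{R}[x_1,\dots,x_n]$, $h_1,\dots,h_n\in\mathcal{L}$, and $$T(F)=\sum_{j=1}^n\frac{\partial p}{\partial x_j}(\Phi(h_1),\dots,\Phi(h_n))\otimes h_j .$$ Stochastic integral operator: $\operatorname{dom}S=\operatorname{dom}T\otimes\mathcal{L}$ (algebraic tensor product), and $S$ is the linear operator with $S(F\otimes k)=F\cdot\Phi(k)-\langle T(F),k\rangle_{\mathcal{L}}$, where $\langle T(F),k\rangle_{\mathcal{L}}=\sum_j\frac{\partial p}{\partial x_j}(\Phi(h_1),\dots,\Phi(h_n))\langle h_j,k\rangle_{\mathcal{L}}$ is a real random variable. A pair $(A,B)$ of densely defined linear operators $A:\operatorname{dom}A\subseteq\mathcal{H}_1\to\mathcal{H}_2$,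 $B:\operatorname{dom}B\subseteq\mathcal{H}_2\to\mathcal{H}_1$ is a symmetric pair if $\langle A\varphi,\psi\rangle_{\mathcal{H}_2}=\langle\varphi,B\psi\rangle_{\mathcal{H}_1}$ for all $\varphi\in\operatorname{dom}A$, $\psi\in\operatorname{dom}B$; it is maximal if $\overline{A}=B^\star$ and $\overline{B}=A^\star$, where the bar denotes closure of an operator. An operator is closable if the closure of its graph is the graph of an operator.
   Formalization: For density of the domains, maximality and the identities T* = closure of S, S* = closure of T, it is assumed that Σ is generated by the Gaussian field up to P-null sets; without this the claim fails (e.g. L = 0 and Ω nontrivial). *)

(* Defs.v *)
From HB Require Import structures.
From mathcomp Require Import all_boot all_order all_algebra.
From mathcomp Require Import all_classical all_reals all_analysis.
From mathcomp Require Import measurable_realfun ess_sup_inf.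
(* mpoly is not imported: its notations clash with those of the analysis
   library. *)
From mathcomp Require mpoly.

Set Implicit Arguments.
Unset Strict Implicit.
Unset Printing Implicit Defensive.

Import Order.TTheory GRing.Theory Num.Theory.
Import numFieldNormedType.Exports.

Local Open Scope classical_set_scope.
Local Open Scope ring_scope.

(* A real inner product inducing the norm; completeness is added separately. *)
HB.mixin Record NormedModule_hasInner (R : realType) V & NormedModule R V := {
  inner : {dot V for idfun} ;
  inner_norm : forall x : V, inner x x = `|x| ^+ 2
}.

#[short(type="preHilbertType")]
HB.structure Definition PreHilbert (R : realType) :=
  {V of NormedModule R V & NormedModule_hasInner R V}.

#[short(type="hilbertType")]
HB.structure Definition Hilbert (R : realType) :=
  {V of PreHilbert R V & CompleteNormedModule R V}.

(* The library gives LspaceType no algebraic structure; here LspaceType2 mu,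
   square-integrable functions modulo a.e. equality, becomes a prehilbert
   space for <f, g> = \int f g and the library's L2 norm. *)
Section L2_algebra.
Context d (T : measurableType d) (R : realType) (mu : {measure set T -> \bar R}).
Local Notation L2 := (LspaceType2 mu).
Local Notation Lf := (LfunType mu (lee1n 2)).
Implicit Types (f g h : L2) (u v : Lf).

HB.instance Definition _ := gen_eqMixin L2.
HB.instance Definition _ := gen_choiceMixin L2.

Lemma L2_measurable f : measurable_fun [set: T] (f : T -> R).
Proof. exact: (@measurable_funPT _ _ _ _ (repr (LebesgueSpace.sort f))). Qed.

Lemma L2_Lfun f : (f : T -> R) \in Lfun mu 2%:E.
Proof.
rewrite inE; apply/andP; split; rewrite inE; first exact: L2_measurable.
by have := @Lebesgue_finite _ _ _ _ _ _ f.
Qed.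

(* A representative of the class f. *)
Definition L2_rep f : Lf := @Lfun_Sub _ _ _ _ _ (lee1n 2) _ (L2_Lfun f).

Lemma L2_ext f g : (f : T -> R) = g %[ae mu] -> f = g.
Proof.
case: f => f [[Pf]]; case: g => g [[Pg]] /= fg.
have {}fg : f = g.
  by rewrite -(reprK f) -(reprK g); apply/eqP; rewrite eqmodE; exact/asboolP.
by subst g; rewrite (Prop_irrelevance Pf Pg).
Qed.

Let Lnorm2_ae_eq (a b : T -> R) :
  measurable_fun setT a -> measurable_fun setT b -> a = b %[ae mu] ->
  Lnorm mu 2%:E (EFin \o a) = Lnorm mu 2%:E (EFin \o b).
Proof.
move=> ma mb ab; rewrite unlock; congr (_ `^ _)%E.
have mp (w : T -> R) : measurable_fun setT w ->
    measurable_fun setT ((fun x => (`|(EFin \o w) x| `^ 2)%E) : T -> \bar R).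
  move=> mw; apply: (measurableT_comp (measurable_poweR _)).
  by apply: measurableT_comp => //; exact/measurable_EFinP.
apply: ge0_ae_eq_integral => //; [exact: mp|exact: mp| | |];
  try by move=> x _; exact: poweR_ge0.
by apply: filterS ab => x /(_ I) /= ->.
Qed.

Section of_Lfun.
Variable u : Lf.

Let u_measurable : @isMeasurableFun d _ T (measurableTypeR R) u.
Proof. by split; exact: (@measurable_funPT _ _ _ _ u). Qed.

Let u_mfun : {mfun T >-> measurableTypeR R} :=
  HB.pack_for {mfun T >-> measurableTypeR R} (u : T -> R) u_measurable.

Let c : {mfun_ mu, T >-> measurableTypeR R} :=
  \pi_({mfun_ mu, T >-> measurableTypeR R})%qT u_mfun.

Let cE : (c : T -> R) = u %[ae mu].
Proof.
suff /asboolP : ae_eq_op mu (repr c) u_mfun by [].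
by rewrite -eqmodE reprK.
Qed.

Let c_finite : @isFinLebesgue d T R mu 2%:E (lee1n 2) c.
Proof.
split; rewrite /finite_norm (Lnorm2_ae_eq _ _ cE).
- exact: Lfunction_finite.
- exact: (@measurable_funPT _ _ _ _ (repr c)).
- exact: measurable_funPT.
Qed.

Definition L2_of : L2 := HB.pack_for L2 c c_finite.

Lemma L2_ofE : (L2_of : T -> R) = u %[ae mu].
Proof. exact: cE. Qed.

End of_Lfun.

Lemma L2_of_eq u v : (u : T -> R) = v %[ae mu] -> L2_of u = L2_of v.
Proof.
move=> uv; apply: L2_ext; apply: ae_eq_trans (L2_ofE u) _.
by apply: ae_eq_trans uv _; exact/ae_eq_sym/L2_ofE.
Qed.

Lemma L2_repK : cancel L2_rep L2_of.
Proof. by move=> f; apply: L2_ext; exact: L2_ofE. Qed.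

Let zero : L2 := L2_of 0.
Let opp f : L2 := L2_of (- L2_rep f).
Let add f g : L2 := L2_of (L2_rep f + L2_rep g).
Let scale (a : R) f : L2 := L2_of (a *: L2_rep f).

Let ofN u : opp (L2_of u) = L2_of (- u).
Proof.
by apply: L2_of_eq; apply: filterS (L2_ofE u) => x /(_ I) e _; congr (- _).
Qed.

Let ofD u v : add (L2_of u) (L2_of v) = L2_of (u + v).
Proof.
apply: L2_of_eq; apply: filterS2 (L2_ofE u) (L2_ofE v).
by move=> x /(_ I) eu /(_ I) ev _; congr (_ + _).
Qed.

Let ofZ a u : scale a (L2_of u) = L2_of (a *: u).
Proof.
by apply: L2_of_eq; apply: filterS (L2_ofE u) => x /(_ I) e _; congr (_ * _).
Qed.

Let addA : associative add.
Proof.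
move=> f g h; rewrite -(L2_repK f) -(L2_repK g) -(L2_repK h).
by rewrite !ofD addrA.
Qed.

Let addC : commutative add.
Proof. by move=> f g; rewrite /add addrC. Qed.

Let add0 : left_id zero add.
Proof. by move=> f; rewrite -(L2_repK f) ofD add0r. Qed.

Let addN : left_inverse zero opp add.
Proof. by move=> f; rewrite -(L2_repK f) ofN ofD addNr. Qed.

HB.instance Definition _ := GRing.isZmodule.Build L2 addA addC add0 addN.

Let scaleA a b f : scale a (scale b f) = scale (a * b) f.
Proof. by rewrite -(L2_repK f) !ofZ scalerA. Qed.

Let scale1 : left_id 1 scale.
Proof. by move=> f; rewrite -(L2_repK f) ofZ scale1r. Qed.

Let scaleDr : right_distributive scale +%R.
Proof.
move=> a f g; rewrite -[f in LHS]L2_repK -[g in LHS]L2_repK [X in scale a X]ofD.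
by rewrite ofZ scalerDr -ofD -!ofZ !L2_repK.
Qed.

Let scaleDl f : {morph scale^~ f : a b / a + b}.
Proof.
by move=> a b; rewrite -(L2_repK f) !ofZ [RHS]ofD scalerDl.
Qed.

HB.instance Definition _ :=
  GRing.Zmodule_isLmodule.Build R L2 scaleA scale1 scaleDr scaleDl.

Lemma L2_addE f g : (f + g : T -> R) = (fun x => f x + g x) %[ae mu].
Proof. exact: L2_ofE. Qed.

Lemma L2_scaleE a f : (a *: f : T -> R) = (fun x => a * f x) %[ae mu].
Proof. exact: L2_ofE. Qed.

Lemma L2_0E : ((0 : L2) : T -> R) = cst 0 %[ae mu].
Proof. exact: L2_ofE. Qed.

Definition L2_inner f g : R := (\int[mu]_x (f x * g x))%R.

Let integrableM f g : mu.-integrable setT (EFin \o (fun x => f x * g x)).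
Proof. exact/Lfun1_integrable/Lfun2_mul_Lfun1/L2_Lfun/L2_Lfun. Qed.

Let innerE (a b : T -> R) : measurable_fun setT a -> measurable_fun setT b ->
  a = b %[ae mu] -> (\int[mu]_x a x = \int[mu]_x b x)%R.
Proof.
move=> ma mb ab; congr fine; apply: ae_eq_integral => //.
- exact/measurable_EFinP.
- exact/measurable_EFinP.
- by apply: filterS ab => x /(_ I) ->.
Qed.

Let innerC f g : L2_inner f g = (-1) ^+ false * idfun (L2_inner g f).
Proof. by rewrite expr0 mul1r; apply: eq_Rintegral => x _; rewrite mulrC. Qed.

Let innerPl g a f h : L2_inner (a *: f + h) g = a * L2_inner f g + L2_inner h g.
Proof.
have intZ : mu.-integrable setT (EFin \o (fun x => a * (f x * g x))).
  have := integrableZl measurableT a (integrableM f g).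
  by apply: eq_integrable => // x _; rewrite /= EFinM.
rewrite /L2_inner -RintegralZl// -RintegralD//.
apply: innerE => //.
- by apply: measurable_funM; exact: L2_measurable.
- apply: measurable_funD; last by apply: measurable_funM; exact: L2_measurable.
  apply: measurable_funM => //.
  by apply: measurable_funM; exact: L2_measurable.
apply: filterS2 (L2_addE (a *: f) h) (L2_scaleE a f).
by move=> x /(_ I) e1 /(_ I) e2 _; rewrite e1 e2 mulrDl mulrA.
Qed.

Let innerPr g a f h : L2_inner g (a *: f + h) = a * L2_inner g f + L2_inner g h.
Proof.
have innerC' f1 f2 : L2_inner f1 f2 = L2_inner f2 f1.
  by rewrite innerC expr0 mul1r.
by rewrite innerC' innerPl !(innerC' g).
Qed.

Let norm f : R := fine (Lnorm mu 2%:E (EFin \o f)).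

Let normE f : (norm f)%:E = Lnorm mu 2%:E (EFin \o f).
Proof. exact: (finite_norm_fine (L2_rep f)). Qed.

Let norm_of u : norm (L2_of u) = fine (Lnorm mu 2%:E (EFin \o u)).
Proof.
congr fine; apply: Lnorm2_ae_eq; last exact: L2_ofE.
- exact: L2_measurable.
- exact: measurable_funPT.
Qed.

Let normD f g : norm (f + g) <= norm f + norm g.
Proof. by rewrite norm_of; exact: ler_LnormD. Qed.

Let normZ a f : norm (a *: f) = `|a| * norm f.
Proof. by rewrite norm_of LnormZ -normE -EFinM. Qed.

Let norm_eq0 f : norm f = 0 -> f = 0.
Proof.
move=> f0; apply: L2_ext; apply: ae_eq_trans (ae_eq_sym L2_0E).
exact: (@fine_Lnormr_eq0 _ _ _ _ _ _ (L2_rep f)).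
Qed.

HB.instance Definition _ :=
  Lmodule_isNormed.Build R L2 normD normZ norm_eq0.

Let inner_norm f : L2_inner f f = `|f| ^+ 2.
Proof.
rewrite [in RHS]/Num.norm/= -powR_mulrn ?fine_ge0 ?Lnorm_ge0//.
apply: EFin_inj; rewrite -poweR_EFin normE powR_Lnorm//.
rewrite fineK; last exact/integrable_fin_num/integrableM.
apply: eq_integral => x _.
by rewrite /= powR_mulrn // -normrX ger0_norm ?sqr_ge0.
Qed.

Let inner_gt0 f : f != 0 -> 0 < L2_inner f f.
Proof. by move=> f0; rewrite inner_norm exprn_gt0// normr_gt0. Qed.

Let inner_bilinear :
  bilinear_for (GRing.Scale.Law.clone _ _ ( *%R ) _)
    (GRing.Scale.Law.clone _ _ (idfun \; *%R ) _) L2_inner.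
Proof.
split=> f; first by move=> a g h; exact: innerPl.
by move=> a g h; exact: innerPr.
Qed.

HB.instance Definition _ :=
  bilinear_isBilinear.Build R L2 L2 R _ _ L2_inner inner_bilinear.
HB.instance Definition _ :=
  isHermitianSesquilinear.Build R L2 false idfun L2_inner innerC.
HB.instance Definition _ := isDotProduct.Build R L2 L2_inner inner_gt0.

HB.instance Definition _ :=
  NormedModule_hasInner.Build R L2 inner_norm.

End L2_algebra.

Section operators.
Context (R : realType).

Definition linear_span (V : lmodType R) (A : set V) : set V :=
  [set x | exists n (c : 'I_n -> R) (v : 'I_n -> V),
     (forall i, A (v i)) /\ x = \sum_(i < n) c i *: v i].

Definition linear_subspace (V : lmodType R) (A : set V) :=
  A 0 /\ forall (a : R) x y, A x -> A y -> A (a *: x + y).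

(* Unbounded operators are represented by their graphs, so that the closure and
   the adjoint below make sense before they are known to be single-valued. *)
Definition is_operator (U V : lmodType R) (G : set (U * V)) :=
  linear_subspace G /\ forall x y y', G (x, y) -> G (x, y') -> y = y'.

Definition dom (U V : Type) (G : set (U * V)) : set U :=
  [set x | exists y, G (x, y)].

Definition closable (U V : normedModType R) (G : set (U * V)) :=
  is_operator (closure G).

Definition adjoint (U V : preHilbertType R) (G : set (U * V)) : set (V * U) :=
  [set z | forall x y, G (x, y) -> inner y z.1 = inner x z.2].

Definition symmetric_pair (U V : preHilbertType R)
    (A : set (U * V)) (B : set (V * U)) :=
  [/\ is_operator A /\ is_operator B, dense (dom A), dense (dom B) &
      forall x Ax y By, A (x, Ax) -> B (y, By) -> inner Ax y = inner x By].

Definition maximal_symmetric_pair (U V : preHilbertType R)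
    (A : set (U * V)) (B : set (V * U)) :=
  [/\ symmetric_pair A B, closure A = adjoint B & closure B = adjoint A].

(* H together with tens is the Hilbert space tensor product of U and V, i.e.
   the completion of the algebraic tensor product for the product inner
   product; this determines (H, tens) up to a unique unitary. *)
Definition hilbert_tensor (U V : preHilbertType R) (H : hilbertType R)
    (tens : {bilinear U -> V -> H}) :=
  (forall f g h k, inner (tens f h) (tens g k) = inner f g * inner h k) /\
  dense (linear_span [set tens f h | f in [set: U] & h in [set: V]]).

End operators.

Section gaussian_field.
Context d (T : measurableType d) (R : realType) (P : probability T R).

(* The law N(m, s^2); normal_prob is meaningful only for s != 0. *)
Definition gaussian_law (m s : R) (A : set R) : \bar R :=
  if s == 0 then \d_m A else normal_prob m s A.

Definition gaussian (X : {RV P >-> R}) :=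
  exists m s, forall A : set R, measurable A ->
    distribution P X A = gaussian_law m s A.

Definition jointly_gaussian n (X : 'I_n -> LspaceType2 P) :=
  forall c : 'I_n -> R, gaussian (L2_rep (\sum_(i < n) c i *: X i)).

Context (L : hilbertType R) (Phi : L -> LspaceType2 P).

Definition gaussian_field :=
  (forall h, 'E_P[Phi h] = 0)%E /\
  forall n (h : 'I_n -> L),
    jointly_gaussian (Phi \o h) /\
    forall i j, covariance P (Phi (h i)) (Phi (h j)) = (inner (h i) (h j))%:E.

(* The sigma-algebra generated by the field is everything up to P-null sets. *)
Definition field_generates :=
  forall A : set T, measurable A ->
    exists2 B, <<s [set C | exists h (U : set R),
                      measurable U /\ C = Phi h @^-1` U] >> B &
               P (A `+` B) = 0%E.

Definition poly_rv n (p : mpoly.mpoly n R) (h : 'I_n -> L) : T -> R :=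
  fun w => mpoly.meval (fun i => Phi (h i) w) p.

Context (H2 : hilbertType R) (tens : {bilinear LspaceType2 P -> L -> H2}).

(* D j is the class of the random variable (dp/dx_j)(Phi(h_1), ..., Phi(h_n)). *)
Definition malliavin : set (LspaceType2 P * H2) := linear_span
  [set z : LspaceType2 P * H2 |
     exists n (p : mpoly.mpoly n R) (h : 'I_n -> L) (D : 'I_n -> LspaceType2 P),
     [/\ (z.1 : T -> R) = poly_rv p h %[ae P],
         forall j, (D j : T -> R) = poly_rv (mpoly.mderiv j p) h %[ae P] &
         z.2 = \sum_(j < n) tens (D j) (h j)]].

Definition stochastic_integral : set (H2 * LspaceType2 P) := linear_span
  [set z : H2 * LspaceType2 P |
     exists n (p : mpoly.mpoly n R) (h : 'I_n -> L)
             (F : LspaceType2 P) (k : L),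
     [/\ (F : T -> R) = poly_rv p h %[ae P],
         z.1 = tens F k &
         (z.2 : T -> R) = (fun w => poly_rv p h w * Phi k w -
            \sum_(j < n) poly_rv (mpoly.mderiv j p) h w * inner (h j) k)
           %[ae P]]].

End gaussian_field.

(* Main.v *)
(** Differentiating the moment generating function E[exp(Phi h)] =
exp(|h|^2 / 2) at h + t g in t, once for each factor, yields Gaussian
integration by parts E[Phi k F] = E[D_k F] for all monomials F in the field, and
hence the symmetry of (T, S). Since T maps into dom S and S into dom T, a limit
violating closability would be orthogonal to a space whose closure contains it.

For maximality, S T maps a monomial of degree n to n times itself plus monomials
of lower degree, so 1 + S T is onto dom T, and 1 + T S is onto dom S. An element
of the adjoint orthogonal to the graph is then orthogonal to a dense domain, and
vanishes. Density of the polynomials: the bounded functions whose multiplication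
operator preserves the closure of the polynomials form an algebra stable under
bounded pointwise limits. It contains sin(t Phi h) and cos(t Phi h), whose Taylor
series are dominated by exp|Phi h|, hence the indicators of {Phi h > r}, and so
those of all events generated by the field. *)

Require Import Defs.
From HB Require Import structures.
From mathcomp Require Import all_boot all_order all_algebra.
From mathcomp Require Import all_classical all_reals all_analysis.
From mathcomp Require Import measurable_realfun ess_sup_inf.
From mathcomp Require Import ring lra.
From mathcomp Require mpoly.

Set Implicit Arguments.
Unset Strict Implicit.
Unset Printing Implicit Defensive.

Import Order.TTheory GRing.Theory Num.Theory.
Import numFieldNormedType.Exports.
(* The algebraic structures of mpoly, without its notations. *)
Import (canonicals, coercions) mpoly.

Local Open Scope classical_set_scope.
Local Open Scope ring_scope.

(** * Inner products and graphs *)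

(** A random variable has many representations p(Phi(h_1), ..., Phi(h_n)), so it is not clear at the
    outset that the gradient depends on F alone. The graphs are therefore treated as linear
    relations: symmetry is checked on generators, the closures are shown to be single-valued, and T
    and S inherit this. Two gradients in [H2] are compared by pairing them with elementary tensors,
    which involves directional derivatives only.

    Monomials are indexed by lists of arbitrary vectors, possibly repeated or dependent, so neither
    an orthonormal basis nor Hermite polynomials occur: a product is a concatenation, and the
    Leibniz rule is a sum over positions.

    A Gaussian law only comes with some parameters m and s; that m = 0 and s^2 = |h|^2 is recovered
    by differentiating the moment generating function. All derivatives are limits of difference
    quotients along the steps 1/(n+1), which brings them within reach of dominated convergence. The
    majorants are exp(|Phi h_1| + ... + |Phi h_r|), integrable because e^|a| <= e^a + e^(-a) and the
    field is linear. *)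

Section inner_theory.
Context {R : realType} {V : preHilbertType R}.
Implicit Types x y z : V.

Lemma innerC x y : inner x y = inner y x.
Proof. by rewrite hermC/= expr0 mul1r. Qed.

Lemma innerDl x y z : inner (x + y) z = inner x z + inner y z.
Proof. by rewrite linearDl. Qed.

Lemma innerDr x y z : inner z (x + y) = inner z x + inner z y.
Proof. by rewrite linearDr. Qed.

Lemma innerZl a x z : inner (a *: x) z = a * inner x z.
Proof. by rewrite linearZl. Qed.

Lemma innerZr a x z : inner z (a *: x) = a * inner z x.
Proof. by rewrite linearZr. Qed.

Lemma innerBl x y z : inner (x - y) z = inner x z - inner y z.
Proof. by rewrite linearBl. Qed.

Lemma innerBr x y z : inner z (x - y) = inner z x - inner z y.
Proof. by rewrite linearBr. Qed.

Lemma inner0l z : inner 0 z = 0 :> R.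
Proof. by rewrite linear0l. Qed.

Lemma inner0r z : inner z 0 = 0 :> R.
Proof. by rewrite linear0r. Qed.

Lemma inner_suml (I : Type) (r : seq I) (F : I -> V) z :
  inner (\sum_(i <- r) F i) z = \sum_(i <- r) inner (F i) z.
Proof. by apply: (big_morph (inner^~ z)) => [x y|]; [exact: innerDl|exact: inner0l]. Qed.

Lemma inner_ge0 x : 0 <= inner x x.
Proof. by rewrite inner_norm sqr_ge0. Qed.

Lemma inner_eq0 x : inner x x = 0 -> x = 0.
Proof. by rewrite inner_norm => /eqP; rewrite sqrf_eq0 normr_eq0 => /eqP. Qed.

(** Cauchy-Schwarz without division: the square norm of |y|^2 x - <x, y> y, a multiple of the part
    of x orthogonal to y, factors as |y|^2 (|x|^2 |y|^2 - <x, y>^2). *)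
Lemma inner_le_norm x y : `|inner x y| <= `|x| * `|y|.
Proof.
have [->|y0] := eqVneq y 0; first by rewrite inner0r normr0 mulr_ge0.
have y2 : 0 < inner y y by rewrite inner_norm exprn_gt0// normr_gt0.
have : 0 <= inner (inner y y *: x - inner x y *: y)
                  (inner y y *: x - inner x y *: y) by exact: inner_ge0.
rewrite innerBl !innerBr !innerZl !innerZr (innerC y x).
set c := inner x y; set b := inner y y in y2 *; set a := inner x x => h.
have {h} : 0 <= b * (a * b - c ^+ 2) by move: h; congr (_ <= _); ring.
rewrite pmulr_rge0// subr_ge0 /a /b !inner_norm -exprMn => h.
by rewrite -ler_sqr ?nnegrE ?mulr_ge0// real_normK ?num_real.
Qed.

End inner_theory.

Section near_orthogonality.
Context (R : realType) (V : lmodType R) (b : V -> V -> R).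
Hypothesis bC : forall x y, b x y = b y x.
Hypothesis bP : forall a x y z, b (a *: x + y) z = a * b x z + b y z.
Hypothesis b_ge0 : forall x, 0 <= b x x.

(** Take [a] whose squared distance to [x] is within [e] of the infimum. Moving from [a] by t a'
    lowers it by at most [e], so 2 t c - t^2 m <= e for every t, and the best t gives c^2 <= e m.
    The form is abstract so that the sum of the inner products on pairs can be used. *)
Lemma near_orthogonal (A : set V) (x : V) (e : R) :
  linear_subspace A -> 0 < e ->
  exists2 a, A a & forall a', A a' -> b (x - a) a' ^+ 2 <= e * b a' a'.
Proof.
move=> [A0 AP] e0.
pose D := [set b (x - a) (x - a) | a in A].
have hD : has_inf D.
  split; first by exists (b (x - 0) (x - 0)), 0.
  by exists 0 => _ [a _ <-]; exact: b_ge0.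
have [_ [a Aa <-] ha] := inf_adherent e0 hD.
exists a => // a' Aa'.
set r := x - a; set c := b r a'; set m := b a' a'.
have bq t : b (r - t *: a') (r - t *: a') = b r r - t *+ 2 * c + t ^+ 2 * m.
  have E z : b (r - t *: a') z = b r z - t * b a' z.
    by rewrite addrC -scaleNr bP mulNr addrC.
  rewrite E (bC r) (bC a') !E (bC a' r) -/c -/m; ring.
have key t : t *+ 2 * c - t ^+ 2 * m <= e.
  have : inf D <= b (r - t *: a') (r - t *: a').
    apply: ge_inf; first by exists 0 => _ [? _ <-]; exact: b_ge0.
    exists (t *: a' + a); first exact: AP.
    by rewrite /r -addrA -opprD (addrC a).
  rewrite bq; move: ha; rewrite -/r; lra.
have [m0|m0] := eqVneq m 0.
  rewrite m0 mulr0; have [->|c0] := eqVneq c 0; first by rewrite expr0n.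
  (* The parabola degenerates to a line, and this value of t would give 2 e <= e. *)
  have := key (e / c); rewrite m0 mulr0 subr0 mulrnAl divfK//.
  by rewrite mulr2n; lra.
have m_gt0 : 0 < m by rewrite lt0r m0 b_ge0.
(* The vertex of the parabola. *)
have := key (c / m); rewrite -ler_pdivrMr//; congr (_ <= _).
by field.
Qed.

End near_orthogonality.

Section subspaces.
Context {R : realType}.
Implicit Types V : lmodType R.

Lemma linear_span_subspace V (A : set V) : linear_subspace (linear_span A).
Proof.
split.
  exists 0%N, (fun=> 0), (fun=> 0); split; first by case.
  by rewrite big_ord0.
move=> a _ _ [n [c [v [Av ->]]]] [m [c' [v' [Av' ->]]]].
exists (n + m)%N, (fun i => match fintype.split i with inl j => a * c j | inr k => c' k end),
  (fun i => match fintype.split i with inl j => v j | inr k => v' k end); split.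
  by move=> i; case: (fintype.split i).
rewrite big_split_ord/= scaler_sumr; congr (_ + _); apply: eq_bigr => i _.
  by rewrite (unsplitK (inl i : 'I_n + 'I_m)%type) scalerA.
by rewrite (unsplitK (inr i : 'I_n + 'I_m)%type).
Qed.

Lemma sub_linear_span V (A : set V) : A `<=` linear_span A.
Proof.
move=> x Ax; exists 1%N, (fun=> 1), (fun=> x); split=> //.
by rewrite big_ord1 scale1r.
Qed.

Lemma subspaceD V (A : set V) x y :
  linear_subspace A -> A x -> A y -> A (x + y).
Proof. by case=> _ h Ax Ay; rewrite -[x]scale1r; exact: h. Qed.

Lemma subspaceZ V (A : set V) a x : linear_subspace A -> A x -> A (a *: x).
Proof. by case=> A0 h Ax; rewrite -[_ *: _]addr0; exact: h. Qed.

Lemma subspaceB V (A : set V) x y :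
  linear_subspace A -> A x -> A y -> A (x - y).
Proof.
by move=> h Ax Ay; apply: subspaceD => //; rewrite -scaleN1r; exact: subspaceZ.
Qed.

Lemma subspace_sum V (A : set V) (I : Type) (r : seq I) (Q : pred I)
    (F : I -> V) :
  linear_subspace A -> (forall i, Q i -> A (F i)) -> A (\sum_(i <- r | Q i) F i).
Proof.
move=> h AF; elim/big_rec: _ => [|i x Qi Ax]; first by case: h.
by apply: subspaceD => //; exact: AF.
Qed.

Lemma linear_span_min V (A B : set V) :
  linear_subspace B -> A `<=` B -> linear_span A `<=` B.
Proof.
move=> sB AB x [n [c [v [Av ->]]]]; apply: subspace_sum => // i _.
by apply: subspaceZ => //; exact: AB.
Qed.

Lemma subspace_dom (U W : lmodType R) (G : set (U * W)) :
  linear_subspace G -> linear_subspace (dom G).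
Proof.
move=> [G0 GP]; split; first by exists 0.
by move=> a x y [x' h] [y' h']; exists (a *: x' + y'); exact: (GP a (_, _) (_, _)).
Qed.

End subspaces.

Section closures.
Context {R : realType}.

Lemma closure_ball (V : normedModType R) (A : set V) x :
  closure A x <-> forall e, 0 < e -> exists2 a, A a & `|x - a| < e.
Proof.
split=> [cA e e0|h U /nbhs_ballP[e e0 xeU]].
  have [a [Aa]] := cA _ (nbhsx_ballx x e e0).
  by rewrite -ball_normE/= => xa; exists a.
have [a Aa xa] := h _ e0; exists a; split=> //; apply: xeU.
by rewrite -ball_normE.
Qed.

Lemma dense_ball (V : normedModType R) (A : set V) :
  dense A <-> forall x e, 0 < e -> exists2 a, A a & `|x - a| < e.
Proof.
split=> [dA x e e0|h O [x Ox] oO].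
  have [|a []] := dA (ball x e) _ (@ball_open _ _ x e).
    by exists x; exact: ballxx.
  by rewrite -ball_normE/= => xa Aa; exists a.
have /nbhs_ballP[e e0 xeO] : nbhs x O by exact: open_nbhs_nbhs.
have [a Aa xa] := h x e e0; exists a; split=> //; apply: xeO.
by rewrite -ball_normE.
Qed.

Lemma closure_ball2 (U V : normedModType R) (G : set (U * V)) z :
  closure G z <-> forall e, 0 < e ->
    exists2 w, G w & `|z.1 - w.1| < e /\ `|z.2 - w.2| < e.
Proof.
split=> [/closure_ball h e e0|h].
  have [w Gw zw] := h _ e0; exists w => //.
  by move: zw; rewrite prod_normE/= gt_max => /andP.
apply/closure_ball => e e0; have [w Gw [h1 h2]] := h _ e0; exists w => //.
by rewrite prod_normE/= gt_max h1 h2.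
Qed.

Lemma subspace_closure (V : normedModType R) (A : set V) :
  linear_subspace A -> linear_subspace (closure A).
Proof.
move=> [A0 AP]; split; first exact: subset_closure.
move=> a x y /closure_ball hx /closure_ball hy; apply/closure_ball => e e0.
have a1 : 0 < `|a| + 1 by rewrite ltr_wpDl.
have e1 : 0 < e / (`|a| + 1) / 2 by rewrite !divr_gt0.
have e2 : 0 < e / 2 by rewrite divr_gt0.
have [x' Ax' xx'] := hx _ e1; have [y' Ay' yy'] := hy _ e2.
exists (a *: x' + y'); first exact: AP.
have -> : a *: x + y - (a *: x' + y') = a *: (x - x') + (y - y').
  by rewrite opprD addrACA scalerBr.
apply: le_lt_trans (ler_normD _ _) _; rewrite normrZ (splitr e).
apply: ler_ltD => //; apply: (@le_trans _ _ ((`|a| + 1) * `|x - x'|)).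
  by rewrite ler_wpM2r// lerDl.
by rewrite mulrC -ler_pdivlMr// mulrAC ltW.
Qed.

(** Only [x] itself has to be approximable: |x|^2 = <x, x - a> <= |x| |x - a| for a in A near x. *)
Lemma inner_dense_eq0 (V : preHilbertType R) (A : set V) x :
  closure A x -> (forall a, A a -> inner x a = 0) -> x = 0.
Proof.
move=> /closure_ball cA h; apply/eqP; rewrite -normr_eq0; apply/eqP.
apply/le_anti; rewrite normr_ge0 andbT; apply/ler_addgt0Pr => e e0.
rewrite add0r; have [a Aa xa] := cA _ e0.
have [->|x0] := eqVneq x 0; first by rewrite normr0 ltW.
rewrite -(@ler_pM2l _ `|x|) ?normr_gt0// -expr2 -inner_norm.
have -> : inner x x = inner x (x - a) by rewrite innerBr (h a)// subr0.
apply: le_trans (ler_norm _) (le_trans (inner_le_norm _ _) _).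
by rewrite ler_wpM2l// ltW.
Qed.

End closures.

(** * Formally adjoint graphs, their closures and their adjoints *)

Section symmetric_pairs.
Context {R : realType}.

Lemma adjoint_subspace (U V : preHilbertType R) (G : set (U * V)) :
  linear_subspace (adjoint G).
Proof.
split; first by move=> x y _ /=; rewrite !inner0r.
move=> a z z' h h' x y Gxy /=.
by rewrite !innerDr !innerZr (h _ _ Gxy) (h' _ _ Gxy).
Qed.

Definition formally_adjoint (U V : preHilbertType R)
    (A : set (U * V)) (B : set (V * U)) :=
  forall x Ax y By, A (x, Ax) -> B (y, By) -> inner Ax y = inner x By.

Lemma formally_adjointC (U V : preHilbertType R) (A : set (U * V))
  (B : set (V * U)) : formally_adjoint A B -> formally_adjoint B A.
Proof. by move=> h y By x Ax hB hA; rewrite innerC -(h _ _ _ _ hA hB) innerC. Qed.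

(** The defect <x, z.1> - <y, z.2> vanishes on A and is continuous in z: replacing z by a point of A
    at distance below delta changes it by at most (|x| + |y|) delta. *)
Lemma closure_sub_adjoint (U V : preHilbertType R) (A : set (U * V))
  (B : set (V * U)) : formally_adjoint A B -> closure A `<=` adjoint B.
Proof.
move=> sym z /closure_ball2 cz y x Byx.
apply/eqP; rewrite -subr_eq0 -normr_eq0; apply/eqP.
apply/le_anti; rewrite normr_ge0 andbT; apply/ler_addgt0Pr => e e0.
rewrite add0r; have d0 : 0 < `|x| + `|y| + 1 by rewrite ltr_wpDl// addr_ge0.
have [[a Aa] /= hA [h1 h2]] := cz _ (divr_gt0 e0 d0).
have -> : inner x z.1 - inner y z.2 = inner x (z.1 - a) - inner y (z.2 - Aa).
  by rewrite !innerBr (innerC x a) (innerC y Aa) (sym _ _ _ _ hA Byx); ring.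
apply: le_trans (ler_normB _ _) _.
apply: (@le_trans _ _ (`|x| * (e / (`|x| + `|y| + 1)) +
                       `|y| * (e / (`|x| + `|y| + 1)))).
  by apply: lerD; apply: le_trans (inner_le_norm _ _) _;
    rewrite ler_wpM2l// ltW.
rewrite -mulrDl mulrA ler_pdivrMr// mulrC ler_pM2l//.
by rewrite lerDl.
Qed.

(** The range condition plays the part that density of [dom B] plays in the usual criterion.
    Closability is thus available before any density result. *)
Lemma closable_of_formally_adjoint (U V : preHilbertType R) (A : set (U * V))
    (B : set (V * U)) :
  linear_subspace A -> formally_adjoint A B ->
  (forall x y, A (x, y) -> dom B y) -> closable A.
Proof.
move=> sA sym ranA; have sC := subspace_closure sA; split=> // x y y' h h'.
apply/eqP; rewrite -subr_eq0; apply/eqP.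
have h0 : closure A (0, y - y').
  by have := subspaceB sC h h'; rewrite /GRing.opp/= -[(x, y) + _]/(x - x, y - y') subrr.
apply: (@inner_dense_eq0 _ _ [set v | exists u, A (u, v)]).
  move/closure_ball2 : h0 => h0; apply/closure_ball => e /h0[[u v] Auv [_ yv]].
  by exists v => //; exists u.
move=> v [u /ranA[w Bvw]].
by have := closure_sub_adjoint sym h0 Bvw; rewrite /= inner0r innerC => <-.
Qed.

(** This is how T and S are shown to be well defined: independence of the chosen polynomial is
    inherited from the closure. *)
Lemma is_operator_sub_closable (U V : normedModType R) (A : set (U * V)) :
  linear_subspace A -> closable A -> is_operator A.
Proof.
move=> sA [_ h]; split=> // x y y' hy hy'.
by apply: (h x); exact: subset_closure.
Qed.

(* A vector of the adjoint orthogonal to the graph of B would be orthogonal to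
   the range of 1 + A B, which is dense. Completeness being unavailable, an
   almost orthogonal residual takes the place of the projection onto the closed
   graph. *)
Lemma adjoint_sub_closure (U V : preHilbertType R) (A : set (U * V))
    (B : set (V * U)) :
  linear_subspace B -> formally_adjoint A B ->
  (forall x y, A (x, y) -> dom B y) -> dense (dom A) -> dense (dom B) ->
  (forall y, dom B y ->
     exists w Bw v, [/\ B (w, Bw), A (Bw, v) & y = w + v]) ->
  adjoint A `<=` closure B.
Proof.
move=> sB sym ranA /dense_ball dA /dense_ball dB surj [y x] Azz.
apply/closure_ball2 => e e0.
pose b (z z' : V * U) := inner z.1 z'.1 + inner z.2 z'.2.
have bC z z' : b z z' = b z' z by rewrite /b (innerC z.1) (innerC z.2).
have bP a z1 z2 z3 : b (a *: z1 + z2) z3 = a * b z1 z3 + b z2 z3.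
  by rewrite /b/= !innerDl !innerZl; ring.
have b0 z : 0 <= b z z by rewrite addr_ge0// inner_ge0.
(* The squared graph norm N^2 of the residual will be a sum of five terms. If e <= N, each is at
   most N^2 / 8, three through e N / 8 and two through q = e^2 / 8, which is absurd. *)
have e8 : 0 < e / 8 by rewrite divr_gt0.
have [v1 dv1 yv1] := dB y _ e8; have [u1 [Au1 hu1] xu1] := dA x _ e8.
have [w1 [Bw1 [y1 [hB1 hA1 def_v1]]]] := surj _ dv1.
have [w2 [Bw2 [y2 [hB2 hA2 def_Au1]]]] := surj _ (ranA _ _ hu1).
pose m1 := b (w1, Bw1) (w1, Bw1); pose m2 := b (w2, Bw2) (w2, Bw2).
pose Z := b (y, x) (y, x); pose q := e ^+ 2 / 8.
have q0 : 0 < q by rewrite divr_gt0// exprn_gt0.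
(* Room for all vectors on which the residual is tested: [m1] and [m2] for the two resolvent points,
   the last two terms for the approximant (v, u) itself. With tolerance q^2 / m, a vector of squared
   norm at most m pairs with the residual to at most q. *)
pose m := m1 + m2 + Z *+ 2 + e ^+ 2 *+ 2.
have m1_ge0 : 0 <= m1 by exact: b0.
have m2_ge0 : 0 <= m2 by exact: b0.
have Z_ge0 : 0 <= Z by exact: b0.
have e2_gt0 : 0 < e ^+ 2 by rewrite exprn_gt0.
have m0 : 0 < m.
  by rewrite /m !mulr2n; lra.
have [[v u] Ba ort] :=
  near_orthogonal bC bP b0 (y, x) sB (divr_gt0 (exprn_gt0 2 q0) m0).
have le_q z : B z -> b z z <= m -> `|b ((y, x) - (v, u)) z| <= q.
  move=> Bz zm; rewrite -ler_sqr ?nnegrE ?(ltW q0)//.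
  rewrite real_normK ?num_real//; apply: le_trans (ort _ Bz) _.
  rewrite -mulrA ler_piMr ?sqr_ge0// mulrC ler_pdivrMr// mul1r//.
exists (v, u) => //=.
have Aa : adjoint A (v, u).
  by apply: (closure_sub_adjoint (formally_adjointC sym)); exact: subset_closure.
have := subspaceB (adjoint_subspace A) Azz Aa.
set r := (y, x) - (v, u) in ort le_q * => Ar.
pose N := Num.sqrt (b r r); have N0 : 0 <= N by exact: sqrtr_ge0.
have N2 : N ^+ 2 = inner r.1 r.1 + inner r.2 r.2 by rewrite sqr_sqrtr.
suff Ne : N < e.
  have r1N : `|r.1| <= N.
    by rewrite -ler_sqr ?nnegrE// N2 !inner_norm lerDl sqr_ge0.
  have r2N : `|r.2| <= N.
    by rewrite -ler_sqr ?nnegrE// N2 !inner_norm lerDr sqr_ge0.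
  by split; apply: le_lt_trans Ne; [exact: r1N|exact: r2N].
rewrite ltNge; apply/negP => eN.
have r1N : `|r.1| <= N.
  by rewrite -ler_sqr ?nnegrE// N2 !inner_norm lerDl sqr_ge0.
have r2N : `|r.2| <= N.
  by rewrite -ler_sqr ?nnegrE// N2 !inner_norm lerDr sqr_ge0.
(* As [r] lies in the adjoint of A, <r.1, w + A B w> is the graph inner product of [r] with (w, B
   w), a point of B, to which [r] is almost orthogonal. *)
have s1 : inner r.1 v1 <= q.
  have -> : inner r.1 v1 = b r (w1, Bw1).
    by rewrite def_v1 innerDr (innerC _ y1) (Ar _ _ hA1) (innerC Bw1).
  apply: le_trans (ler_norm _) (le_q _ hB1 _).
  by rewrite -/m1 /m !mulr2n; lra.
have s2 : inner r.2 u1 <= q.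
  have -> : inner r.2 u1 = b r (w2, Bw2).
    rewrite innerC -(Ar _ _ hu1) def_Au1 innerDl (Ar _ _ hA2) innerC.
    by rewrite (innerC Bw2).
  apply: le_trans (ler_norm _) (le_q _ hB2 _).
  by rewrite -/m2 /m !mulr2n; lra.
have s3 : - b r (v, u) <= e * N / 8.
  apply: le_trans (ler_norm _) _; rewrite normrN.
  rewrite -ler_sqr ?nnegrE ?divr_ge0 ?mulr_ge0 ?(ltW e0)//.
  rewrite real_normK ?num_real//; apply: le_trans (ort _ Ba) _.
  (* Parallelogram inequality for (v, u) = (y, x) - r. *)
  have av : b (v, u) (v, u) <= Z *+ 2 + N ^+ 2 *+ 2.
    have : 0 <= b ((y, x) + r) ((y, x) + r) by exact: b0.
    have -> : (v, u) = (-1) *: r + (y, x).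
      by rewrite scaleN1r /r opprB subrK.
    have -> : (y, x) + r = 1 *: (y, x) + r by rewrite scale1r.
    rewrite !bP ![b _ ((-1) *: r + _)]bC ![b _ (1 *: _ + _)]bC !bP.
    rewrite -/Z (bC (y, x) r) (_ : b r r = N ^+ 2); last by rewrite N2.
    by rewrite !mulr2n; lra.
  (* Since e <= N, the bound 2 Z + 2 N^2 is at most m N^2 / e^2, and q / e = e / 8. *)
  have -> : (e * N / 8) ^+ 2 = q ^+ 2 / m * (m * N ^+ 2 / e ^+ 2).
    by rewrite /q; field; rewrite !gt_eqF.
  rewrite ler_wpM2l ?divr_ge0 ?sqr_ge0 ?(ltW m0)//; apply: le_trans av _.
  rewrite ler_pdivlMr ?exprn_gt0//.
  have eN2 : e ^+ 2 <= N ^+ 2 by rewrite ler_sqr ?nnegrE// ltW.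
  rewrite mulrDl; apply: (@le_trans _ _ (Z *+ 2 * N ^+ 2 + e ^+ 2 *+ 2 * N ^+ 2)).
    apply: lerD; first by rewrite ler_wpM2l// mulrn_wge0.
    by rewrite !mulrnAl mulrC.
  rewrite -mulrDl ler_wpM2r ?sqr_ge0// /m -[m1 + m2 + _ + _]addrA.
  by rewrite lerDr addr_ge0 ?b0.
have s4 : inner r.1 (y - v1) <= e * N / 8.
  apply: le_trans (ler_norm _) (le_trans (inner_le_norm _ _) _).
  by rewrite mulrC mulrAC; apply: ler_pM => //; exact: ltW.
have s5 : inner r.2 (x - u1) <= e * N / 8.
  apply: le_trans (ler_norm _) (le_trans (inner_le_norm _ _) _).
  by rewrite mulrC mulrAC; apply: ler_pM => //; exact: ltW.
have : N ^+ 2 = inner r.1 (y - v1) + inner r.1 v1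
              + (inner r.2 (x - u1) + inner r.2 u1) - b r (v, u).
  rewrite N2 /b /r/= !innerBr; ring.
have h1 : e * N <= N ^+ 2 by rewrite expr2 ler_wpM2r.
have h2 : q <= N ^+ 2 / 8.
  by rewrite ler_pM2r ?invr_gt0// ler_sqr ?nnegrE// ltW.
have : 0 < N ^+ 2 by rewrite exprn_gt0// (lt_le_trans e0).
lra.
Qed.

(* The resolvents are related by (1 + A B)^-1 = 1 - A (1 + B A)^-1 B. *)
Lemma resolvent_swap (U V : preHilbertType R) (A : set (U * V))
    (B : set (V * U)) :
  linear_subspace A -> linear_subspace B ->
  (forall x y, A (x, y) -> dom B y) -> (forall x y, B (x, y) -> dom A y) ->
  (forall x, dom A x -> exists w Aw u, [/\ A (w, Aw), B (Aw, u) & x = w + u]) ->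
  forall y, dom B y -> exists w Bw v, [/\ B (w, Bw), A (Bw, v) & y = w + v].
Proof.
move=> sA sB ranA ranB surj y [x Byx].
have [g [Ag [u [hA hB def_x]]]] := surj _ (ranB _ _ Byx).
exists (y - Ag), g, Ag; split=> //; last by rewrite subrK.
have -> : g = x - u by rewrite def_x addrK.
exact: (subspaceB sB Byx hB).
Qed.

(** The two nontrivial inclusions need 1 + B A onto [dom A] and 1 + A B onto [dom B]; the first is
    assumed and [resolvent_swap] supplies the second. *)
Lemma adjoint_closure (U V : preHilbertType R) (A : set (U * V))
    (B : set (V * U)) :
  linear_subspace A -> linear_subspace B -> formally_adjoint A B ->
  (forall x y, A (x, y) -> dom B y) -> (forall x y, B (x, y) -> dom A y) ->
  dense (dom A) -> dense (dom B) ->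
  (forall x, dom A x -> exists w Aw u, [/\ A (w, Aw), B (Aw, u) & x = w + u]) ->
  adjoint A = closure B /\ adjoint B = closure A.
Proof.
move=> sA sB sym ranA ranB dA dB surj; split; apply/seteqP; split.
- apply: adjoint_sub_closure => //.
  exact: (resolvent_swap sA sB ranA ranB surj).
- exact/closure_sub_adjoint/formally_adjointC.
- by apply: adjoint_sub_closure => //; exact: formally_adjointC.
- exact: closure_sub_adjoint.
Qed.

End symmetric_pairs.

(** * Exponential moments of the field *)

Section density.
Context d (T : measurableType d) (R : realType).
Variables (mu nu : {measure set T -> \bar R}) (p : T -> R).
Hypothesis p_ge0 : forall x, 0 <= p x.
Hypothesis mp : measurable_fun [set: T] p.
Hypothesis nuE : forall A, measurable A -> (nu A = \int[mu]_(x in A) (p x)%:E)%E.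

Import HBNNSimple.

Let integral_density_indic E : measurable E ->
  (\int[nu]_x (\1_E x)%:E = \int[mu]_x ((\1_E x)%:E * (p x)%:E))%E.
Proof.
move=> mE; rewrite integral_indic// setIT nuE// integral_mkcond.
apply: eq_integral => x _; rewrite patchE indicE.
by case: ifPn => xE; rewrite ?mul1e ?mul0e.
Qed.

Let integral_density_nnsfun (f : {nnsfun T >-> R}) :
  (\int[nu]_x (f x)%:E = \int[mu]_x ((f x)%:E * (p x)%:E))%E.
Proof.
under [LHS]eq_integral do rewrite fimfunE -fsumEFin//.
rewrite [LHS]ge0_integral_fsum//; last 2 first.
  - by move=> r; exact/measurable_EFinP/measurableT_comp.
  - by move=> n x _; rewrite EFinM nnfun_muleindic_ge0.
under [RHS]eq_integral.
  move=> x xD; rewrite fimfunE -fsumEFin// muleC ge0_mule_fsumr; last first.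
    by move=> r; rewrite EFinM nnfun_muleindic_ge0.
  over.
rewrite [RHS]ge0_integral_fsum//; last 2 first.
  - move=> r; apply/measurable_EFinP/measurable_funM => //.
    exact: measurableT_comp.
  - move=> n x _; rewrite EFinM mule_ge0//; first by rewrite lee_fin.
    by rewrite nnfun_muleindic_ge0.
apply: eq_fsbigr => r _.
under [RHS]eq_integral do rewrite EFinM muleCA.
have [r0|r0] := leP 0 r.
  rewrite [RHS]ge0_integralZl//; last 2 first.
  - by apply: emeasurable_funM; exact/measurable_EFinP.
  - by move=> t _; rewrite -EFinM lee_fin mulr_ge0.
  - by rewrite !integralZl_indic_nnsfun// integral_density_indic//; congr (_ * _)%E;
      apply: eq_integral => x _; rewrite muleC.
(* A negative value is never attained, so its level set is empty. *)
have rE x : (\1_(f @^-1` [set r]) x : R) = 0.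
  rewrite indicE memNset//= => fx; move: r0; rewrite -fx ltNge.
  by rewrite fun_ge0.
rewrite !integral0_eq// => x _; rewrite rE; first by rewrite mule0 mule0.
by rewrite mulr0.
Qed.

Lemma ge0_integral_density (f : T -> \bar R) :
  measurable_fun [set: T] f -> (forall x, 0 <= f x)%E ->
  (\int[nu]_x f x = \int[mu]_x (f x * (p x)%:E))%E.
Proof.
move=> mf f0; pose g := nnsfun_approx measurableT mf.
have mg n : measurable_fun [set: T] (EFin \o g n).
  by apply/measurable_EFinP.
have gf x : (g n x)%:E @[n --> \oo] --> f x by exact: cvg_nnsfun_approx.
have nd x m n : (m <= n)%N -> ((g m x)%:E <= (g n x)%:E)%E.
  by move=> mn; rewrite lee_fin; exact/lefP/nd_nnsfun_approx.
transitivity (limn (fun n => \int[nu]_x (g n x)%:E)%E).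
  rewrite -monotone_convergence//=.
  - by apply: eq_integral => x _; apply/esym/cvg_lim.
  - by move=> n x _; rewrite lee_fin.
  - by move=> x _ m n; exact: nd.
transitivity (limn (fun n => \int[mu]_x ((g n x)%:E * (p x)%:E))%E).
  by apply: congr_lim; apply/funext => n; exact: integral_density_nnsfun.
rewrite -monotone_convergence//=.
- apply: eq_integral => x _; apply/cvg_lim => //.
  by apply: cvgeZr => //; exact: gf.
- by move=> n; apply: emeasurable_funM => //; exact/measurable_EFinP.
- by move=> n x _; rewrite -EFinM lee_fin mulr_ge0.
- by move=> x _ m n mn; rewrite lee_wpmul2r// ?lee_fin//; exact: nd.
Qed.

End density.

Section gaussian_exp.
Context d (T : measurableType d) (R : realType) (P : probability T R).

(** Completing the square: e^(t x) times the density of N(m, s^2) is e^(m t + s^2 t^2 / 2) times the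
    density of N(m + t s^2, s^2), which has total mass 1. For s = 0 the law is a Dirac mass and the
    formula is immediate. *)
Lemma gaussian_expR (X : {RV P >-> R}) : gaussian X ->
  exists m s, forall t,
    (\int[P]_x (expR (t * X x))%:E = (expR (m * t + s ^+ 2 * t ^+ 2 / 2))%:E)%E.
Proof.
move=> [m [s law]]; exists m, s => t.
(* normal_prob is a measure on measurableTypeR R, whose display differs from
   that of R although the measurable sets are the same. *)
pose Y : {mfun T >-> measurableTypeR R} := HB.pack_for {mfun T >-> measurableTypeR R}
  (X : T -> R) (@isMeasurableFun.Build _ _ _ (measurableTypeR R) (X : T -> R)
    (@measurable_funPT _ _ _ _ X)).
pose e x : \bar R := (expR (t * x))%:E.
have me : measurable_fun [set: R] e.
  by apply/measurable_EFinP; apply: measurableT_comp.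
have me' : measurable_fun [set: measurableTypeR R] e by exact: me.
have e0 x : (0 <= e x)%E by rewrite lee_fin expR_ge0.
rewrite -[LHS](ge0_integral_distribution (Y : {RV P >-> _}) me' e0).
have [s0|s0] := eqVneq s 0.
  rewrite (@eq_measure_integral _ (measurableTypeR R) R setT
      (@dirac _ (measurableTypeR R) m R)); last first.
    by move=> A mA _; have := law A mA; rewrite /gaussian_law s0 eqxx.
  rewrite integral_dirac// diracT mul1e /e; congr (expR _)%:E.
  by rewrite s0 expr0n/= !mul0r addr0 mulrC.
rewrite (@eq_measure_integral _ (measurableTypeR R) R setT
    (normal_prob m s)); last first.
  by move=> A mA _; have := law A mA; rewrite /gaussian_law (negbTE s0).
rewrite (@ge0_integral_density _ _ _ lebesgue_measure _ (normal_pdf m s))//.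
- transitivity (\int[lebesgue_measure]_x
    ((expR (m * t + s ^+ 2 * t ^+ 2 / 2))%:E *
     (normal_pdf (m + t * s ^+ 2) s x)%:E))%E.
    apply: eq_integral => x _; rewrite /e -!EFinM; congr EFin.
    rewrite !normal_pdfE// mulrCA [RHS]mulrCA; congr (_ * _).
    rewrite /normal_fun -!expRD; congr expR.
    rewrite !mulr2n; field.
    by rewrite -mulr2n mulrn_eq0/= expf_eq0/=.
  rewrite (@ge0_integralZl _ _ _ lebesgue_measure setT measurableT
    (fun x => (normal_pdf (m + t * s ^+ 2) s x)%:E))//.
  - by rewrite integral_normal_pdf mule1.
  - by apply/measurable_EFinP; exact: measurable_normal_pdf.
  - by move=> x _; rewrite lee_fin normal_pdf_ge0.
- by move=> x; exact: normal_pdf_ge0.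
- exact: measurable_normal_pdf.
Qed.

End gaussian_exp.

Section square_integrable.
Context d (T : measurableType d) (R : realType) (P : probability T R).

Local Notation L2 := (LspaceType2 P).

Lemma L2_linE_ae (a : R) (F G : L2) :
  ((a *: F + G : L2) : T -> R) = (fun x => a * F x + G x) %[ae P].
Proof.
by apply: filterS2 (L2_addE (a *: F) G) (L2_scaleE a F) => x /(_ I) -> /(_ I) ->.
Qed.

Lemma L2_eq_of_ae (F G : L2) (f : T -> R) : (F : T -> R) = f %[ae P] ->
  (G : T -> R) = f %[ae P] -> F = G.
Proof. by move=> Ff Gf; apply: L2_ext; apply: ae_eq_trans Ff (ae_eq_sym Gf). Qed.

Lemma L2_subE_ae (F G : L2) (f g : T -> R) : (F : T -> R) = f %[ae P] ->
  (G : T -> R) = g %[ae P] -> ((F - G : L2) : T -> R) = (fun x => f x - g x) %[ae P].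
Proof.
move=> Ff Gg; rewrite addrC -scaleN1r; apply: filterS3 (L2_linE_ae (-1) G F) Ff Gg.
by move=> x /(_ I) -> /(_ I) -> /(_ I) -> _; rewrite mulN1r addrC.
Qed.

Lemma Lfun2_of_sqr (f : T -> R) : measurable_fun [set: T] f ->
  P.-integrable setT (EFin \o (fun x => f x ^+ 2)) -> f \in Lfun P 2%:E.
Proof.
move=> mf /integrableP[_ fi]; rewrite inE; apply/andP; split; rewrite inE//=.
rewrite /finite_norm unlock; apply: poweR_lty.
rewrite (eq_integral (fun x => abse (f x ^+ 2)%:E))// => x _.
by rewrite /= powR_mulrn// -normrX.
Qed.

Lemma L2_exists (f : T -> R) : f \in Lfun P 2%:E ->
  exists F : L2, (F : T -> R) = f %[ae P].
Proof. by move=> hf; exists (L2_of (Lfun_Sub (lee1n 2) hf)); exact: L2_ofE. Qed.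

Lemma ae_eq_Rintegral (f g : T -> R) : measurable_fun [set: T] f ->
  measurable_fun [set: T] g -> f = g %[ae P] ->
  (\int[P]_x f x = \int[P]_x g x)%R.
Proof.
move=> mf mg fg; congr fine; apply: ae_eq_integral => //.
- exact/measurable_EFinP.
- exact/measurable_EFinP.
- by apply: filterS fg => x /(_ I) ->.
Qed.

Lemma ae_integrable (f g : T -> R) : measurable_fun [set: T] f ->
  P.-integrable setT (EFin \o g) -> f = g %[ae P] ->
  P.-integrable setT (EFin \o f).
Proof.
move=> mf /integrableP[mg gi] fg; apply/integrableP; split.
  exact/measurable_EFinP.
rewrite (@ae_eq_integral _ _ _ _ _ (fun x => abse (g x)%:E))//.
- by apply: measurableT_comp => //; exact/measurable_EFinP.
- exact: measurableT_comp.
- by apply: filterS fg => x /(_ I) /= ->.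
Qed.

Lemma innerE (F G : L2) (f g : T -> R) : measurable_fun [set: T] f ->
  measurable_fun [set: T] g -> (F : T -> R) = f %[ae P] ->
  (G : T -> R) = g %[ae P] -> inner F G = (\int[P]_x (f x * g x))%R.
Proof.
move=> mf mg Ff Gg; apply: ae_eq_Rintegral.
- by apply: measurable_funM; exact: L2_measurable.
- exact: measurable_funM.
- by apply: filterS2 Ff Gg => x /(_ I) -> /(_ I) ->.
Qed.

Lemma cvg_Rintegral (f_ : nat -> T -> R) (f g : T -> R) :
  (forall n, measurable_fun [set: T] (f_ n)) -> measurable_fun [set: T] f ->
  P.-integrable setT (EFin \o g) ->
  (forall n x, `|f_ n x| <= g x) -> (forall x, f_ ^~ x @ \oo --> f x) ->
  (\int[P]_x f_ n x)%R @[n --> \oo] --> (\int[P]_x f x)%R.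
Proof.
move=> mf_ mf ig fg ff.
have [|||||fi _ h] := @dominated_convergence _ _ _ P setT measurableT
  (fun n => EFin \o f_ n) (EFin \o f) (EFin \o g).
- by move=> n; exact/measurable_EFinP.
- exact/measurable_EFinP.
- by apply: aeW => x _; apply/fine_cvgP; split; [exact: nearW|exact: ff].
- exact: ig.
- by apply: aeW => x n _; rewrite lee_fin.
apply: fine_cvg; rewrite fineK//.
exact: integrable_fin_num fi.
Qed.

(** Dominated convergence in mean square: (f - f_n)^2 is at most (2 g)^2, which is integrable. *)
Lemma dominated_closure (A : set (L2)) (F : L2)
    (f_ : nat -> T -> R) (f g : T -> R) :
  (forall n, measurable_fun [set: T] (f_ n)) -> measurable_fun [set: T] f ->
  (forall n, exists2 F' : L2, A F' & (F' : T -> R) = f_ n %[ae P]) ->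
  (F : T -> R) = f %[ae P] -> g \in Lfun P 2%:E ->
  (forall n x, `|f_ n x| <= g x) -> (forall x, f_ ^~ x @ \oo --> f x) ->
  closure A F.
Proof.
move=> mf_ mf hf_ Ff g2 fg ff; apply/closure_ball => e e0.
have mg : measurable_fun [set: T] g.
  by move: g2; rewrite inE => /andP[]; rewrite inE.
have ig : P.-integrable setT (EFin \o (fun x => 4 * g x ^+ 2)).
  have := integrableZl measurableT 4 (Lfun2_integrable_sqr g2).
  by apply: eq_integrable => // x _; rewrite /= EFinM.
have f_le x : `|f x| <= g x.
  apply: (ler_cvg_to (cvg_norm (ff x)) (cvg_cst (g x))).
  by apply: nearW => n; exact: fg.
have h : (\int[P]_x (f x - f_ n x) ^+ 2)%R @[n --> \oo] --> (0 : R).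
  rewrite [X in _ --> X](_ : _ = (\int[P]_x 0)%R); last first.
    by rewrite Rintegral_cst// mul0r.
  apply: (cvg_Rintegral _ _ ig) => //.
  - by move=> n; apply: measurable_funX; exact: measurable_funB.
  - move=> n x; rewrite ger0_norm ?sqr_ge0// -real_normK ?num_real//.
    rewrite (_ : 4 * g x ^+ 2 = (g x + g x) ^+ 2); last by ring.
    rewrite ler_sqr ?nnegrE ?addr_ge0//; last 2 first.
      exact: le_trans (normr_ge0 _) (f_le x).
      exact: le_trans (normr_ge0 _) (f_le x).
    by rewrite (le_trans (ler_normB _ _))// lerD.
  - move=> x; rewrite [X in _ --> X](_ : _ = (f x - f x) ^+ 2); last first.
      by rewrite subrr expr0n.
    apply: (@cvg_comp _ _ _ (fun n => f x - f_ n x) (fun y => y ^+ 2)).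
      by apply: cvgB; [exact: cvg_cst|exact: ff].
    exact: exprn_continuous.
have : \forall n \near \oo, (\int[P]_x (f x - f_ n x) ^+ 2)%R < e ^+ 2.
  by apply: cvgr_lt h _ _; rewrite exprn_gt0.
case=> N _ /(_ N (leqnn N)) /= hN.
have [F' AF' F'f] := hf_ N; exists F' => //.
rewrite -ltr_sqr ?nnegrE ?(ltW e0)// -inner_norm.
have FF' := L2_subE_ae Ff F'f.
by rewrite (innerE _ _ FF' FF')//; exact: measurable_funB.
Qed.

End square_integrable.

(** * Linearity of the field and functions of at most exponential growth in it *)

Section exponential_growth.
Context (R : realType) (L : hilbertType R).
Context d (T : measurableType d) (P : probability T R).
Context (Phi : L -> LspaceType2 P) (hPhi : gaussian_field Phi).

Lemma measurable_Phi h : measurable_fun [set: T] (Phi h).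
Proof. exact: L2_measurable. Qed.

(** The field is an isometry: its means vanish, so the covariance in a two-element family is
    E[Phi h Phi g]. *)
Lemma inner_Phi h g : inner (Phi h) (Phi g) = inner h g.
Proof.
have [_ /(_ ord0 ord_max)] := hPhi.2 2%N (fun i : 'I_2 => if i == ord0 then h else g).
have L1 (f : LspaceType2 P) : (f : T -> R) \in Lfun P 1.
  apply: Lfun_subset12; last exact: L2_Lfun.
  exact: fin_num_measure.
rewrite /= covarianceE; [|exact: L1|exact: L1|exact/Lfun2_mul_Lfun1/L2_Lfun/L2_Lfun].
by rewrite !hPhi.1 mule0 sube0 unlock => hg; rewrite /inner/= /L2_inner /Rintegral hg.
Qed.

(** Linearity is a consequence of the covariance: the square norm of the difference of the two sides
    expands into inner products in [L] that cancel. *)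
Lemma PhiP a h g : Phi (a *: h + g) = a *: Phi h + Phi g.
Proof.
apply/eqP; rewrite -subr_eq0; apply/eqP/inner_eq0.
rewrite !(innerBl, innerBr, innerDl, innerDr, innerZl, innerZr, inner_Phi).
by rewrite (innerC g h); ring.
Qed.

Lemma PhiP_ae a h g :
  (Phi (a *: h + g) : T -> R) = (fun x => a * Phi h x + Phi g x) %[ae P].
Proof. by rewrite PhiP; exact: L2_linE_ae.
Qed.

Lemma Phi_sum_ae (s : seq (R * L)) :
  (Phi (\sum_(p <- s) p.1 *: p.2) : T -> R) =
  (fun x => \sum_(p <- s) p.1 * Phi p.2 x) %[ae P].
Proof.
elim: s => [|p s IHs].
  rewrite big_nil (_ : Phi 0 = 0).
    by apply: filterS (L2_0E P) => x /(_ I) -> _; rewrite big_nil.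
  by apply: inner_eq0; rewrite inner_Phi inner0l.
rewrite big_cons; have h := PhiP_ae p.1 p.2 (\sum_(q <- s) q.1 *: q.2).
by apply: filterS2 h IHs => x /(_ I) -> /(_ I) -> _; rewrite big_cons.
Qed.

Lemma mgf_Phi h : exists m s, forall t,
  (\int[P]_x (expR (t * Phi h x))%:E = (expR (m * t + s ^+ 2 * t ^+ 2 / 2))%:E)%E.
Proof.
have [/(_ (fun=> 1)) gh _] := hPhi.2 1%N (fun=> h).
have [m [s mgf]] := gaussian_expR gh; exists m, s => t; rewrite -mgf.
by congr integral; apply/funext => x; rewrite big_ord1 scale1r.
Qed.

Lemma integrable_expR_Phi h : P.-integrable setT (EFin \o (fun x => expR (Phi h x))).
Proof.
have [m [s /(_ 1) mgf]] := mgf_Phi h; apply/integrableP; split.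
  apply/measurable_EFinP; apply: measurableT_comp => //; exact: measurable_Phi.
rewrite (eq_integral (fun x => (expR (1 * Phi h x))%:E)).
  by rewrite mgf ltry.
by move=> x _ /=; rewrite ger0_norm ?expR_ge0// mul1r.
Qed.

(** A family of majorants closed under products, by concatenation, and dominating both monomials and
    exponentials of the field. *)
Definition expbound (s : seq L) (x : T) : R := expR (\sum_(h <- s) `|Phi h x|).

Lemma expbound_gt0 s x : 0 < expbound s x. Proof. exact: expR_gt0. Qed.

Lemma expbound_ge1 s x : 1 <= expbound s x.
Proof. by rewrite -expR0 ler_expR sumr_ge0. Qed.

Lemma expbound_cat s t x : expbound (s ++ t) x = expbound s x * expbound t x.
Proof. by rewrite /expbound big_cat expRD. Qed.

Lemma measurable_expbound s : measurable_fun [set: T] (expbound s).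
Proof.
apply: measurableT_comp => //; apply: measurable_sum => h.
by apply: measurableT_comp => //; exact: measurable_Phi.
Qed.

(** By e^|a| <= e^a + e^(-a), each |Phi h| moves into the linear exponent with coefficient 1 or -1,
    which is why the statement carries the list [l]. When [s] is exhausted the exponent is almost
    everywhere a single Phi g, whose exponential moment is finite. *)
Let integrable_expbound_aux s (l : seq (R * L)) : P.-integrable setT
  (EFin \o (fun x => expR (\sum_(p <- l) p.1 * Phi p.2 x) * expbound s x)).
Proof.
have mexp l' : measurable_fun [set: T]
    (fun x => expR (\sum_(p <- l') p.1 * Phi p.2 x)).
  apply: measurableT_comp => //; apply: measurable_sum => p.
  by apply: measurable_funM => //; exact: measurable_Phi.
have mfun s' l' : measurable_fun [set: T]
    (fun x => expR (\sum_(p <- l') p.1 * Phi p.2 x) * expbound s' x).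
  by apply: measurable_funM => //; exact: measurable_expbound.
elim: s l => [|h s IHs] l.
  apply: ae_integrable (mfun _ _)
    (integrable_expR_Phi (\sum_(p <- l) p.1 *: p.2)) _.
  apply: filterS (Phi_sum_ae l) => x /(_ I) -> _.
  by rewrite /expbound big_nil expR0 mulr1.
have := integrableD measurableT (IHs ((1, h) :: l)) (IHs ((-1, h) :: l)).
apply: le_integrable => //; first exact/measurable_EFinP/mfun.
move=> x _ /=; rewrite lee_fin !big_cons/= /expbound big_cons.
rewrite [leRHS]ger0_norm ?addr_ge0 ?mulr_ge0 ?expR_ge0//.
rewrite ger0_norm ?mulr_ge0 ?expR_ge0//.
rewrite mul1r mulN1r -!expRD.
have [x0|x0] := leP 0 (Phi h x).
  rewrite ger0_norm// (_ : _ + (Phi h x + _) =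
    Phi h x + \sum_(p <- l) p.1 * Phi p.2 x + \sum_(j <- s) `|Phi j x|).
    by rewrite lerDl expR_ge0.
  by ring.
rewrite ltr0_norm// (_ : _ + (- Phi h x + _) =
  - Phi h x + \sum_(p <- l) p.1 * Phi p.2 x + \sum_(j <- s) `|Phi j x|).
  by rewrite lerDr expR_ge0.
by ring.
Qed.

Lemma integrable_expbound s : P.-integrable setT (EFin \o expbound s).
Proof.
have := integrable_expbound_aux s [::].
by apply: eq_integrable => // x _; rewrite /= big_nil expR0 mul1r.
Qed.

(** The class containing all the integrands below: stable under sums and products, and contained in
    both L1 and L2, so that integrability never has to be examined case by case. *)
Definition growth (f : T -> R) := measurable_fun [set: T] f /\
  exists c s, forall x, `|f x| <= c * expbound s x.

Lemma growthP f : growth f -> exists c s, 0 <= c /\ forall x, `|f x| <= c * expbound s x.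
Proof.
move=> [_ [c [s fcs]]]; exists `|c|, s; split=> // x.
by apply: le_trans (fcs x) _; rewrite ler_wpM2r ?ler_norm// ltW// expbound_gt0.
Qed.

Lemma growth_measurable f : growth f -> measurable_fun [set: T] f.
Proof. by case. Qed.

Lemma growth_le (f g : T -> R) : measurable_fun [set: T] f -> growth g ->
  (forall x, `|f x| <= `|g x|) -> growth f.
Proof.
move=> mf [_ [c [s gcs]]] fg; split=> //; exists c, s => x.
exact: le_trans (fg x) (gcs x).
Qed.

Lemma growth_cst c : growth (fun=> c).
Proof.
split; first exact: measurable_cst.
exists `|c|, [::] => x; rewrite ler_peMr//; exact: expbound_ge1.
Qed.

Lemma growthD f g : growth f -> growth g -> growth (fun x => f x + g x).
Proof.
move=> gf gg; have [mf _] := gf; have [mg _] := gg.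
have [c1 [s1 [c10 h1]]] := growthP gf; have [c2 [s2 [c20 h2]]] := growthP gg.
split; first exact: measurable_funD.
exists (c1 + c2), (s1 ++ s2) => x; rewrite expbound_cat.
apply: le_trans (ler_normD _ _) _; rewrite mulrDl; apply: lerD.
  apply: le_trans (h1 x) _; rewrite ler_wpM2l// ler_peMr//.
    exact/ltW/expbound_gt0.
  exact: expbound_ge1.
apply: le_trans (h2 x) _; rewrite ler_wpM2l// ler_peMl//.
  exact/ltW/expbound_gt0.
exact: expbound_ge1.
Qed.

Lemma growthM f g : growth f -> growth g -> growth (fun x => f x * g x).
Proof.
move=> [mf [c1 [s1 h1]]] [mg [c2 [s2 h2]]]; split; first exact: measurable_funM.
exists (c1 * c2), (s1 ++ s2) => x; rewrite expbound_cat normrM mulrACA.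
exact: ler_pM.
Qed.

Lemma growthZ a f : growth f -> growth (fun x => a * f x).
Proof. exact/growthM/growth_cst. Qed.

Lemma growth_expbound s : growth (expbound s).
Proof.
split; first exact: measurable_expbound.
by exists 1, s => x; rewrite mul1r ger0_norm// ltW// expbound_gt0.
Qed.

Lemma growth_expR_Phi h : growth (fun x => expR (Phi h x)).
Proof.
apply: growth_le (growth_expbound [:: h]) _.
  by apply: measurableT_comp => //; exact: measurable_Phi.
move=> x; rewrite !ger0_norm ?expR_ge0 ?(ltW (expbound_gt0 _ _))//.
by rewrite ler_expR big_seq1 ler_norm.
Qed.

Lemma growth_Phi h : growth (Phi h).
Proof.
apply: growth_le (measurable_Phi h) (growth_expbound [:: h]) _ => x.
rewrite [leRHS]ger0_norm ?(ltW (expbound_gt0 _ _))// /expbound big_seq1.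
by apply: le_trans (expR_ge1Dx _); rewrite lerDr.
Qed.

Lemma growth_integrable f : growth f -> P.-integrable setT (EFin \o f).
Proof.
move=> gf; have [mf _] := gf; have [c [s [c0 h]]] := growthP gf.
have := integrableZl measurableT c (integrable_expbound s).
apply: le_integrable => //; first exact/measurable_EFinP.
move=> x _ /=; rewrite lee_fin; apply: le_trans (h x) _.
exact: ler_norm.
Qed.

Lemma growth_Lfun f : growth f -> f \in Lfun P 2%:E.
Proof.
move=> gf; apply: Lfun2_of_sqr; first by case: gf.
exact/growth_integrable/growthM.
Qed.

End exponential_growth.

(** * Gaussian integration by parts *)

Section expR_difference_quotient.
Context (R : realType).
Implicit Types u x : R.

Lemma cvg_seqD (u v : nat -> R) (a b : R) : u @ \oo --> a -> v @ \oo --> b ->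
  u n + v n @[n --> \oo] --> a + b.
Proof. exact: cvgD. Qed.

Lemma cvg_seqM (u v : nat -> R) (a b : R) : u @ \oo --> a -> v @ \oo --> b ->
  u n * v n @[n --> \oo] --> a * b.
Proof. exact: cvgM. Qed.

Lemma cvg_seq_cst (a : R) : (fun _ : nat => a) @ \oo --> a.
Proof. exact: cvg_cst. Qed.

(** Serves to dominate the difference quotients of exp uniformly in the step. *)
Lemma norm_expRB1 u : `|expR u - 1| <= `|u| * expR `|u|.
Proof.
have h : `|u| <= `|u| * expR `|u| by rewrite ler_peMr// -expR0 ler_expR.
have h1 := expR_ge1Dx u; have [u0|u0] := leP 0 u.
  rewrite ger0_norm ?subr_ge0 -?[X in X <= _]expR0 ?ler_expR// (ger0_norm u0).
  have -> : expR u - 1 = (1 - expR (- u)) * expR u.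
    by rewrite mulrBl mul1r -expRD addNr expR0.
  by rewrite ler_wpM2r ?expR_ge0//; have := expR_ge1Dx (- u); lra.
rewrite ler0_norm ?subr_le0 -?[X in _ <= X]expR0 ?ler_expR ?(ltW u0)//.
by apply: le_trans h; rewrite ltr0_norm//; lra.
Qed.

Lemma cvg_invSn : (n.+1%:R^-1 : R) @[n --> \oo] --> (0 : R).
Proof. exact: cvg_harmonic. Qed.

(** From u <= e^u - 1 <= u e^u, the quotient lies between [y n] and [y n] times a factor tending to
    1. A sequence [y] is allowed so that it can absorb the second-order part of a quadratic
    exponent. *)
Lemma cvg_expR_quotient (y : nat -> R) x : y @ \oo --> x ->
  n.+1%:R * (expR (n.+1%:R^-1 * y n) - 1) @[n --> \oo] --> x.
Proof.
move=> yx; have c0 : n.+1%:R^-1 * y n @[n --> \oo] --> (0 : R).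
  by rewrite -(mul0r x); apply: cvgM => //; exact: cvg_invSn.
have c1 : expR (n.+1%:R^-1 * y n) @[n --> \oo] --> (1 : R).
  rewrite -[X in _ --> X]expR0.
  by apply: (cvg_comp _ _ c0); exact: continuous_expR.
apply: (@squeeze_cvgr _ _ _ _ y (fun n => expR (n.+1%:R^-1 * y n) * y n)) => //.
  apply: nearW => n; set u := n.+1%:R^-1 * y n.
  have -> : y n = n.+1%:R * u by rewrite /u mulVKf// pnatr_eq0.
  move: u => u; rewrite mulrCA !ler_pM2l ?ltr0n// lerBrDl expR_ge1Dx/=.
  have -> : expR u - 1 = expR u * (1 - expR (- u)).
    by rewrite mulrBr mulr1 -expRD subrr expR0.
  by rewrite ler_wpM2l ?expR_ge0//; have := expR_ge1Dx (- u); lra.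
by rewrite -[X in _ --> X]mul1r; exact: cvgM.
Qed.

End expR_difference_quotient.
Arguments cvg_seq_cst {R} a.

Section integration_by_parts.
Context (R : realType) (L : hilbertType R).
Context d (T : measurableType d) (P : probability T R).
Context (Phi : L -> LspaceType2 P) (hPhi : gaussian_field Phi).

Lemma eq_mean (g f : T -> R) : f =1 g -> (\int[P]_x f x = \int[P]_x g x)%R.
Proof. by move=> fg; apply: eq_Rintegral => x _. Qed.
Arguments eq_mean g {f}.

(** Differentiation under the expectation of E[Y exp(t Phi h)] at t = 0, along t = 1/(n+1). As these
    steps are at most 1, the quotients are dominated by |Y Phi h| exp|Phi h|. *)
Lemma cvg_expR_Phi_quotient (Y : T -> R) h : growth Phi Y ->
  n.+1%:R * ((\int[P]_x (Y x * expR (n.+1%:R^-1 * Phi h x)))%R - (\int[P]_x Y x)%R)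
    @[n --> \oo] --> (\int[P]_x (Y x * Phi h x))%R.
Proof.
move=> gY; have mY := growth_measurable gY.
have mPhi := measurable_Phi Phi h.
have mexp a : measurable_fun [set: T] (fun x => expR (a * Phi h x)).
  by apply: measurableT_comp => //; exact: measurable_funM.
pose f n x := Y x * (n.+1%:R * (expR (n.+1%:R^-1 * Phi h x) - 1)).
pose g x := `|Y x * (Phi h x * expbound Phi [:: h] x)|.
have gg : growth Phi (fun x => Y x * (Phi h x * expbound Phi [:: h] x)).
  by apply/growthM/growthM => //; [exact: growth_Phi|exact: growth_expbound].
have quot_le n x : `|n.+1%:R * (expR (n.+1%:R^-1 * Phi h x) - 1)| <=
    `|Phi h x * expbound Phi [:: h] x|.
  rewrite !normrM (ger0_norm (ltW (expbound_gt0 _ _ _))) (@ger0_norm _ n.+1%:R)//.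
  apply: (@le_trans _ _ (n.+1%:R * (`|n.+1%:R^-1 * Phi h x| *
      expR `|n.+1%:R^-1 * Phi h x|))).
    by rewrite ler_wpM2l// norm_expRB1.
  rewrite normrM ger0_norm ?invr_ge0// !mulrA divff ?pnatr_eq0// mul1r.
  rewrite ler_wpM2l// /expbound big_seq1 ler_expR.
  by rewrite ler_piMl// invf_le1 ?ltr0n// ler1n.
have ig : P.-integrable setT (EFin \o g).
  by have := integrable_norm (growth_integrable hPhi gg).
have : (\int[P]_x f n x)%R @[n --> \oo] --> (\int[P]_x (Y x * Phi h x))%R.
  apply: (cvg_Rintegral _ _ ig).
  - move=> n; apply: measurable_funM => //; apply: measurable_funM => //.
    by apply: measurable_funB.
  - by apply: measurable_funM.
  - by move=> n x; rewrite /f /g normrM [leRHS]normrM ler_wpM2l.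
  - move=> x; apply: cvgM; first exact: cvg_cst.
    by apply: cvg_expR_quotient; exact: cvg_cst.
apply: cvg_trans; apply: near_eq_cvg; apply: nearW => n.
have gexp : growth Phi (fun x => Y x * expR (n.+1%:R^-1 * Phi h x)).
  apply: growthM => //; apply: growth_le (growth_expbound Phi [:: h]) _ => //.
  move=> x; rewrite !ger0_norm ?expR_ge0 ?(ltW (expbound_gt0 _ _ _))//.
  rewrite /expbound big_seq1 ler_expR (le_trans (ler_norm _))// normrM.
  by rewrite ger0_norm// ler_piMl// invf_le1 ?ltr0n// ler1n.
rewrite -RintegralB//; [|exact: growth_integrable gexp|exact: growth_integrable gY].
rewrite -RintegralZl//.
  by apply: eq_mean => x; rewrite /f; ring.
by have := integrableB measurableT (growth_integrable hPhi gexp) (growth_integrable hPhi gY).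
Qed.

Arguments cvg_expR_Phi_quotient {Y} h.

(** Differentiability implies continuity: the increment is the convergent quotient times 1/(n+1). *)
Lemma cvg_expR_Phi (Y : T -> R) h : growth Phi Y ->
  (\int[P]_x (Y x * expR (n.+1%:R^-1 * Phi h x)))%R
    @[n --> \oo] --> (\int[P]_x Y x)%R.
Proof.
move=> gY; have := cvg_seqD (cvg_seqM (@cvg_invSn R) (cvg_expR_Phi_quotient h gY))
  (cvg_seq_cst (\int[P]_x Y x)%R).
rewrite mul0r add0r.
apply: cvg_trans; apply: near_eq_cvg; apply: nearW => n /=.
by rewrite mulKf ?pnatr_eq0// subrK.
Qed.

Arguments cvg_expR_Phi {Y} h.

Lemma Rintegral_expR_Phi_shift (Z : T -> R) a h g : measurable_fun [set: T] Z ->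
  (\int[P]_x (Z x * expR (Phi (a *: h + g) x)))%R =
  (\int[P]_x (Z x * expR (Phi g x) * expR (a * Phi h x)))%R.
Proof.
move=> mZ; have mh := measurable_Phi Phi h; have mg := measurable_Phi Phi g.
have mhg := measurable_Phi Phi (a *: h + g); apply: ae_eq_Rintegral.
- by apply: measurable_funM => //; apply: measurableT_comp.
- apply: measurable_funM; last by apply: measurableT_comp => //; exact: measurable_funM.
  by apply: measurable_funM => //; apply: measurableT_comp.
- by apply: filterS (PhiP_ae hPhi a h g) => x /(_ I) -> _; rewrite expRD; ring.
Qed.

Lemma Phi0_ae : (Phi 0 : T -> R) = cst 0 %[ae P].
Proof.
rewrite (_ : Phi 0 = 0); last by apply: inner_eq0; rewrite inner_Phi// inner0l.
exact: L2_0E.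
Qed.

Lemma Rintegral_expR_Phi0 (Z : T -> R) : measurable_fun [set: T] Z ->
  (\int[P]_x (Z x * expR (Phi 0 x)))%R = (\int[P]_x Z x)%R.
Proof.
move=> mZ; apply: ae_eq_Rintegral => //.
  apply: measurable_funM => //; apply: measurableT_comp => //; exact: measurable_Phi.
by apply: filterS Phi0_ae => x /(_ I) -> _; rewrite expR0 mulr1.
Qed.

(** The parameters of the law are identified from its moment generating function: the first
    derivative at 0 is the mean, giving m = 0, and the second is E[(Phi h)^2] = |h|^2, giving
    s^2. *)
Lemma mgf_Phi_variance h : (\int[P]_x expR (Phi h x))%R = expR (inner h h / 2).
Proof.
have [m [s mgf0]] := mgf_Phi hPhi h.
have mgf t : (\int[P]_x expR (t * Phi h x))%R = expR (m * t + s ^+ 2 * t ^+ 2 / 2).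
  by rewrite /Rintegral mgf0.
have int0 : (\int[P]_x (Phi h x))%R = 0.
  by have := hPhi.1 h; rewrite unlock /Rintegral => ->.
have int1 : (\int[P]_x 1)%R = 1.
  rewrite (Rintegral_cst P measurableT 1) mul1r.
  by have /= -> := probability_setT P.
have m0 : m = 0.
  have c := cvg_expR_Phi_quotient h (growth_cst Phi 1).
  have e0 : (\int[P]_x (1 * Phi h x))%R = 0.
    by under eq_mean do rewrite mul1r; exact: int0.
  rewrite e0 in c; apply: (cvg_unique (@Rhausdorff R) _ c).
  have : m + s ^+ 2 / 2 * n.+1%:R^-1 @[n --> \oo] --> m.
    rewrite -[X in _ --> X]addr0; apply: cvgD; first exact: cvg_cst.
    rewrite -(mulr0 (s ^+ 2 / 2)); apply: cvgM; first exact: cvg_cst.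
    exact: cvg_invSn.
  move=> /cvg_expR_quotient; apply: cvg_trans; apply: near_eq_cvg.
  apply: nearW => n; rewrite [X in _ = _ * (X - _)](eq_mean
      (fun x => expR (n.+1%:R^-1 * Phi h x))); last by move=> x; rewrite mul1r.
  rewrite mgf int1; congr (_ * (expR _ - _)).
  ring.
have shift t n : (\int[P]_x (expR (t * Phi h x) * expR (n.+1%:R^-1 * Phi h x)))%R =
    expR (s ^+ 2 * (t + n.+1%:R^-1) ^+ 2 / 2).
  under eq_mean do rewrite -expRD -mulrDl.
  by rewrite mgf m0 mul0r add0r.
have var_s : inner h h = s ^+ 2.
  (* First derivative of the moment generating function at t = 1/(n+1); its own difference quotient
     at 0 then yields the second derivative. *)
  have tilt n : (\int[P]_x (Phi h x * expR (n.+1%:R^-1 * Phi h x)))%R =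
      s ^+ 2 * n.+1%:R^-1 * expR (s ^+ 2 * n.+1%:R^-1 ^+ 2 / 2).
    set t : R := n.+1%:R^-1.
    have gt : growth Phi (fun x => expR (t * Phi h x)).
      apply: growth_le (growth_expbound Phi [:: h]) _ => //.
        apply: measurableT_comp => //; apply: measurable_funM => //.
        exact: measurable_Phi.
      move=> x; rewrite !ger0_norm ?expR_ge0 ?(ltW (expbound_gt0 _ _ _))//.
      rewrite /expbound big_seq1 ler_expR (le_trans (ler_norm _))// normrM.
      by rewrite ger0_norm ?invr_ge0// ler_piMl// invf_le1 ?ltr0n// ler1n.
    have c := cvg_expR_Phi_quotient h gt.
    rewrite (eq_mean (fun x => expR (t * Phi h x) * Phi h x)); last first.
      by move=> x; rewrite mulrC.
    apply: (cvg_unique (@Rhausdorff R) c).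
    (* Passing from t to t + 1/(k+1) raises the exponent s^2 t^2 / 2 by 1/(k+1) times this
       sequence. *)
    have : s ^+ 2 * t + s ^+ 2 / 2 * k.+1%:R^-1 @[k --> \oo] --> s ^+ 2 * t.
      rewrite -[X in _ --> X]addr0; apply: cvgD; first exact: cvg_cst.
      rewrite -(mulr0 (s ^+ 2 / 2)); apply: cvgM; first exact: cvg_cst.
      exact: cvg_invSn.
    move=> /cvg_expR_quotient h1.
    have := cvg_seqM h1 (cvg_seq_cst (expR (s ^+ 2 * t ^+ 2 / 2))).
    apply: cvg_trans; apply: near_eq_cvg.
    apply: nearW => k /=; rewrite shift mgf m0 mul0r add0r.
    rewrite -mulrA mulrBl mul1r -expRD; congr (_ * (expR _ - _)).
    by move: k.+1%:R^-1 => K; field.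
  have c := cvg_expR_Phi_quotient h (growth_Phi Phi h).
  rewrite int0 in c; rewrite -(inner_Phi hPhi).
  apply: (cvg_unique (@Rhausdorff R) c).
  have h0 : s ^+ 2 * n.+1%:R^-1 ^+ 2 / 2 @[n --> \oo] --> (0 : R).
    rewrite [X in _ --> X](_ : 0 = s ^+ 2 * (0 * 0) / 2); last by ring.
    apply: cvgM; last exact: cvg_cst; apply: cvgM; first exact: cvg_cst.
    by under eq_fun do rewrite expr2; apply: cvgM; exact: cvg_invSn.
  have h1 : expR (s ^+ 2 * n.+1%:R^-1 ^+ 2 / 2) @[n --> \oo] --> (1 : R).
    by rewrite -[X in _ --> X]expR0; apply: (cvg_comp _ _ h0); exact: continuous_expR.
  have := cvg_seqM (cvg_seq_cst (s ^+ 2)) h1; rewrite mulr1.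
  apply: cvg_trans; apply: near_eq_cvg; apply: nearW => n /=.
  rewrite tilt subr0; have : n.+1%:R != 0 :> R by rewrite pnatr_eq0.
  by move: n.+1%:R (expR _) => N e N0; field.
have := mgf 1; under eq_mean do rewrite mul1r.
by rewrite m0 mul0r add0r expr1n mulr1 -var_s.
Qed.

Definition prodPhi (s : seq L) (x : T) : R := \prod_(h <- s) Phi h x.

(* D_k F for the monomial F = prodPhi s. *)
Fixpoint dprodPhi (k : L) (s : seq L) (x : T) : R :=
  if s is g :: s' then inner g k * prodPhi s' x + Phi g x * dprodPhi k s' x else 0.

Lemma prodPhi_cons g s x : prodPhi (g :: s) x = Phi g x * prodPhi s x.
Proof. by rewrite /prodPhi big_cons. Qed.

Lemma prodPhi_cat s t x : prodPhi (s ++ t) x = prodPhi s x * prodPhi t x.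
Proof. by rewrite /prodPhi big_cat. Qed.

Lemma dprodPhi_cat k s t x : dprodPhi k (s ++ t) x =
  dprodPhi k s x * prodPhi t x + prodPhi s x * dprodPhi k t x.
Proof.
elim: s => [|g s IHs] /=; first by rewrite /prodPhi big_nil mul0r add0r mul1r.
by rewrite IHs prodPhi_cat prodPhi_cons; ring.
Qed.

Lemma growth_prodPhi s : growth Phi (prodPhi s).
Proof.
elim: s => [|g s IHs].
  rewrite (_ : prodPhi _ = fun=> 1); first exact: growth_cst.
  by apply/funext => x; rewrite /prodPhi big_nil.
rewrite (_ : prodPhi _ = fun x => Phi g x * prodPhi s x).
  by apply: growthM => //; exact: growth_Phi.
by apply/funext => x; rewrite prodPhi_cons.
Qed.

Lemma growth_dprodPhi k s : growth Phi (dprodPhi k s).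
Proof.
elim: s => [|g s IHs] /=; first exact: growth_cst.
apply: growthD; first by apply: growthZ; exact: growth_prodPhi.
by apply: growthM => //; exact: growth_Phi.
Qed.

(* Differentiating the identity at h + t g in t, at t = 0, multiplies the
   monomial by Phi g: the case of the empty monomial is the derivative of the
   moment generating function. *)
Lemma expR_integration_by_parts k s h :
  (\int[P]_x (Phi k x * prodPhi s x * expR (Phi h x)))%R =
  inner h k * (\int[P]_x (prodPhi s x * expR (Phi h x)))%R +
  (\int[P]_x (dprodPhi k s x * expR (Phi h x)))%R.
Proof.
have gE f : growth Phi f -> growth Phi (fun x => f x * expR (Phi h x)).
  by move=> gf; apply: growthM => //; exact: growth_expR_Phi.
(* The vector [h] stays general because the induction hypothesis is applied at h + g/(n+1) as well
   as at h. *)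
elim: s h gE => [|g s IHs] h gE.
  rewrite [X in _ = _ + X](_ : _ = 0); last first.
    rewrite (eq_mean (fun=> 0)); first by rewrite Rintegral_cst// mul0r.
    by move=> x; rewrite mul0r.
  rewrite addr0 (eq_mean (fun x => expR (Phi h x) * Phi k x)); last first.
    by move=> x; rewrite /prodPhi big_nil mulr1 mulrC.
  rewrite [X in _ = _ * X](eq_mean (fun x => expR (Phi h x))); last first.
    by move=> x; rewrite /prodPhi big_nil mul1r.
  rewrite mgf_Phi_variance.
  have c := cvg_expR_Phi_quotient k (growth_expR_Phi Phi h).
  apply: (cvg_unique (@Rhausdorff R) c).
  (* The exponent |h + k/(n+1)|^2 / 2 exceeds |h|^2 / 2 by 1/(n+1) times this sequence. *)
  have : inner h k + inner k k / 2 * n.+1%:R^-1 @[n --> \oo] --> inner h k.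
    rewrite -[X in _ --> X]addr0; apply: cvgD; first exact: cvg_cst.
    rewrite -(mulr0 (inner k k / 2)); apply: cvgM; first exact: cvg_cst.
    exact: cvg_invSn.
  move=> /cvg_expR_quotient h1.
  have := cvg_seqM h1 (cvg_seq_cst (expR (inner h h / 2))).
  apply: cvg_trans; apply: near_eq_cvg; apply: nearW => n /=.
  have sh := Rintegral_expR_Phi_shift n.+1%:R^-1 k h (measurable_cst (1 : R)).
  rewrite [X in _ = _ * (X - _)](eq_mean
    (fun x => 1 * expR (Phi h x) * expR (n.+1%:R^-1 * Phi k x))); last first.
    by move=> x; rewrite mul1r.
  rewrite -sh; under [in RHS]eq_mean do rewrite mul1r.
  rewrite !mgf_Phi_variance.
  rewrite -mulrA mulrBl mul1r -expRD; congr (_ * (expR _ - _)).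
  rewrite !(innerDl, innerDr, innerZl, innerZr) (innerC h k).
  by move: n.+1%:R^-1 => N; field.
have gs := growth_prodPhi s; have gd := growth_dprodPhi k s.
have gk := growth_Phi Phi k.
rewrite (eq_mean (fun x => Phi k x * prodPhi s x * expR (Phi h x) * Phi g x));
  last by move=> x; rewrite prodPhi_cons; ring.
rewrite [X in _ = _ * X + _](eq_mean
    (fun x => prodPhi s x * expR (Phi h x) * Phi g x)); last first.
  by move=> x; rewrite prodPhi_cons; ring.
rewrite [X in _ = _ + X](_ : _ = inner g k * (\int[P]_x (prodPhi s x * expR (Phi h x)))%R
    + (\int[P]_x (dprodPhi k s x * expR (Phi h x) * Phi g x))%R); last first.
  rewrite -RintegralZl//; last exact/growth_integrable/gE.
  rewrite -RintegralD//.
  - by apply: eq_mean => x /=; ring.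
  - exact/growth_integrable/growthZ/gE.
  - exact: (growth_integrable hPhi (growthM (gE _ gd) (growth_Phi Phi g))).
have c0 := cvg_expR_Phi_quotient g (gE _ (growthM gk gs)).
have c1 := cvg_expR_Phi_quotient g (gE _ gs).
have c2 := cvg_expR_Phi_quotient g (gE _ gd).
(* In the product rule the factor <h + t g, k> has the exact quotient <g, k>, so its companion
   integral only has to be continuous. *)
have c3 := cvg_expR_Phi g (gE _ gs).
apply: (cvg_unique (@Rhausdorff R) c0).
rewrite addrA.
have := cvg_seqD (cvg_seqD (cvg_seqM (cvg_seq_cst (inner h k)) c1)
  (cvg_seqM (cvg_seq_cst (inner g k)) c3)) c2.
apply: cvg_trans; apply: near_eq_cvg; apply: nearW => n /=.
have sh f : growth Phi f -> _ := fun gf =>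
  Rintegral_expR_Phi_shift n.+1%:R^-1 g h (growth_measurable gf).
rewrite -(sh _ (growthM gk gs)) -(sh _ gs) -(sh _ gd).
have gE' f : growth Phi f ->
    growth Phi (fun x => f x * expR (Phi (n.+1%:R^-1 *: g + h) x)).
  by move=> gf; apply: growthM => //; exact: growth_expR_Phi.
rewrite !IHs// innerDl innerZl.
have : n.+1%:R != 0 :> R by rewrite pnatr_eq0.
by move: n.+1%:R => N N0; field.
Qed.

Lemma integration_by_parts k s :
  (\int[P]_x (Phi k x * prodPhi s x))%R = (\int[P]_x dprodPhi k s x)%R.
Proof.
have := expR_integration_by_parts k s 0.
rewrite inner0l mul0r add0r !Rintegral_expR_Phi0//.
  exact/growth_measurable/growth_dprodPhi.
apply: measurable_funM; first exact: measurable_Phi.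
exact/growth_measurable/growth_prodPhi.
Qed.

End integration_by_parts.

(** * Polynomials as combinations of monomials *)

Section polynomials.
Context (R : realType) (L : hilbertType R).
Context d (T : measurableType d) (P : probability T R).
Context (Phi : L -> LspaceType2 P).
Local Notation prodPhi := (prodPhi Phi).
Local Notation dprodPhi := (dprodPhi Phi).

(** The random variable <T(F), k> of the definition of S, computed from the formal partial
    derivatives. *)
Definition grad_rv n (p : mpoly.mpoly n R) (h : 'I_n -> L) (k : L) (w : T) : R :=
  \sum_(j < n) poly_rv Phi (mpoly.mderiv j p) h w * inner (h j) k.

(** One and the same list of coefficients and monomials must expand both the function and its
    directional derivatives, so the expansion commutes with differentiation. *)
Definition poly_grad (f : T -> R) (f' : L -> T -> R) :=
  exists cs : seq (R * seq L),
    (forall w, f w = \sum_(c <- cs) c.1 * prodPhi c.2 w) /\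
    (forall k w, f' k w = \sum_(c <- cs) c.1 * dprodPhi k c.2 w).

Lemma poly_gradD f f' g g' u u' : poly_grad f f' -> poly_grad g g' ->
  (forall w, u w = f w + g w) -> (forall k w, u' k w = f' k w + g' k w) ->
  poly_grad u u'.
Proof.
move=> [cs [hf hf']] [ds [hg hg']] hu hu'; exists (cs ++ ds); split=> [w|k w].
  by rewrite hu hf hg big_cat.
by rewrite hu' hf' hg' big_cat.
Qed.

Lemma poly_gradM f f' g g' u u' : poly_grad f f' -> poly_grad g g' ->
  (forall w, u w = f w * g w) ->
  (forall k w, u' k w = f' k w * g w + f w * g' k w) -> poly_grad u u'.
Proof.
move=> [cs [hf hf']] [ds [hg hg']] hu hu'.
exists [seq (c.1 * e.1, c.2 ++ e.2) | c <- cs, e <- ds]; split=> [w|k w].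
  rewrite hu hf hg big_allpairs_dep mulr_suml; apply: eq_bigr => c _.
  rewrite mulr_sumr; apply: eq_bigr => e _ /=.
  by rewrite prodPhi_cat; ring.
rewrite hu' hf hf' hg hg' big_allpairs_dep !mulr_suml -big_split.
apply: eq_bigr => c _ /=; rewrite !mulr_sumr -big_split.
by apply: eq_bigr => e _ /=; rewrite dprodPhi_cat; ring.
Qed.

Lemma poly_grad_cst c : poly_grad (fun=> c) (fun _ _ => 0).
Proof.
exists [:: (c, [::])]; split=> [w|k w].
  by rewrite big_seq1 /prodPhi big_nil mulr1.
by rewrite big_seq1 /= mulr0.
Qed.

Lemma poly_grad_Phi g : poly_grad (Phi g) (fun k _ => inner g k).
Proof.
exists [:: (1, [:: g])]; split=> [w|k w].
  by rewrite big_seq1 mul1r prodPhi_cons /prodPhi big_nil mulr1.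
by rewrite big_seq1 /= mulr0 addr0 mul1r /prodPhi big_nil mulr1.
Qed.

Section one_family.
Context n (h : 'I_n -> L).
Implicit Types p q : mpoly.mpoly n R.

Lemma poly_rvD p q w : poly_rv Phi (p + q) h w = poly_rv Phi p h w + poly_rv Phi q h w.
Proof. exact: mpoly.mevalD. Qed.

Lemma poly_rvM p q w : poly_rv Phi (p * q) h w = poly_rv Phi p h w * poly_rv Phi q h w.
Proof. exact: mpoly.mevalM. Qed.

Lemma poly_rvX i w : poly_rv Phi (mpoly.mpolyX R (mpoly.mnm1 i)) h w = Phi (h i) w.
Proof. exact: mpoly.mevalXU. Qed.

Lemma poly_rvC c w : poly_rv Phi (mpoly.mpolyC n c) h w = c.
Proof. exact: mpoly.mevalC. Qed.

Lemma grad_rvD p q k w : grad_rv (p + q) h k w = grad_rv p h k w + grad_rv q h k w.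
Proof.
rewrite /grad_rv -big_split; apply: eq_bigr => j _ /=.
by rewrite mpoly.mderivD poly_rvD mulrDl.
Qed.

Lemma grad_rvM p q k w : grad_rv (p * q) h k w =
  grad_rv p h k w * poly_rv Phi q h w + poly_rv Phi p h w * grad_rv q h k w.
Proof.
rewrite /grad_rv mulr_suml mulr_sumr -big_split; apply: eq_bigr => j _ /=.
by rewrite mpoly.mderivM poly_rvD !poly_rvM; ring.
Qed.

Lemma grad_rvC c k w : grad_rv (mpoly.mpolyC n c) h k w = 0.
Proof.
rewrite /grad_rv big1// => j _; rewrite mpoly.mderivC.
by rewrite /poly_rv mpoly.meval0 mul0r.
Qed.

Lemma grad_rvX i k w :
  grad_rv (mpoly.mpolyX R (mpoly.mnm1 i)) h k w = inner (h i) k.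
Proof.
rewrite /grad_rv (bigD1 i)//= big1 ?addr0 => [|j ji]; rewrite mpoly.mderivX.
  rewrite mpoly.mnm1E eqxx scale1r (_ : mpoly.mnm_sub _ _ = mpoly.mnm0).
    by rewrite mpoly.mpolyX0 /poly_rv mpoly.meval1 mul1r.
  by apply/mpoly.mnmP => j; rewrite mpoly.mnmBE mpoly.mnm0E subnn.
rewrite mpoly.mnm1E eq_sym (negbTE ji) scale0r.
by rewrite /poly_rv mpoly.meval0 mul0r.
Qed.

(** Formal derivatives and [dprodPhi] both satisfy the Leibniz rule and agree on constants and
    variables, from which [p] is built by sums and products. *)
Lemma poly_grad_poly_rv p : poly_grad (poly_rv Phi p h) (grad_rv p h).
Proof.
have hC c : poly_grad (poly_rv Phi (mpoly.mpolyC n c) h) (grad_rv (mpoly.mpolyC n c) h).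
  have [cs [e1 e2]] := poly_grad_cst c; exists cs; split=> [w|k w].
    by rewrite poly_rvC.
  by rewrite grad_rvC.
have hD p1 p2 : poly_grad (poly_rv Phi p1 h) (grad_rv p1 h) ->
    poly_grad (poly_rv Phi p2 h) (grad_rv p2 h) ->
    poly_grad (poly_rv Phi (p1 + p2) h) (grad_rv (p1 + p2) h).
  move=> h1 h2; apply: (poly_gradD h1 h2) => [w|k w]; first exact: poly_rvD.
  exact: grad_rvD.
have hM p1 p2 : poly_grad (poly_rv Phi p1 h) (grad_rv p1 h) ->
    poly_grad (poly_rv Phi p2 h) (grad_rv p2 h) ->
    poly_grad (poly_rv Phi (p1 * p2) h) (grad_rv (p1 * p2) h).
  move=> h1 h2; apply: (poly_gradM h1 h2) => [w|k w]; first exact: poly_rvM.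
  exact: grad_rvM.
have hX i : poly_grad (poly_rv Phi (mpoly.mpolyX R (mpoly.mnm1 i)) h)
    (grad_rv (mpoly.mpolyX R (mpoly.mnm1 i)) h).
  have [cs [e1 e2]] := poly_grad_Phi (h i); exists cs; split=> [w|k w].
    by rewrite poly_rvX.
  by rewrite grad_rvX -(e2 k w).
pose ok q := poly_grad (poly_rv Phi q h) (grad_rv q h).
rewrite (mpoly.mpolyE p); apply: (big_rec ok) => [|m q _ hq].
  by have := hC 0; rewrite mpoly.mpolyC0.
apply: hD => //; rewrite -mpoly.mul_mpolyC; apply: (hM); first exact: hC.
rewrite mpoly.mpolyXE_id; apply: (big_ind ok).
- exact: (hC 1).
- exact: hM.
- move=> i _; elim: (m i) => [|e IHe]; first exact: (hC 1).
  by rewrite exprS; apply: (hM).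
Qed.

Lemma prodPhi_poly (l : seq 'I_n) : exists p : mpoly.mpoly n R,
  (forall w, poly_rv Phi p h w = prodPhi (map h l) w) /\
  (forall k w, grad_rv p h k w = dprodPhi k (map h l) w).
Proof.
elim: l => [|i l [p [e1 e2]]].
  exists (mpoly.mpolyC n 1); split=> [w|k w]; last by rewrite grad_rvC.
  by rewrite poly_rvC /prodPhi big_nil.
exists (mpoly.mpolyX R (mpoly.mnm1 i) * p); split=> [w|k w].
  by rewrite poly_rvM poly_rvX e1 /= prodPhi_cons.
by rewrite grad_rvM poly_rvX grad_rvX e1 e2.
Qed.

End one_family.

(** Every position of [s] receives its own variable, so repeated vectors call for no exponents. *)
Lemma prodPhi_poly_rv (s : seq L) : exists n (h : 'I_n -> L) (p : mpoly.mpoly n R),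
  (forall w, poly_rv Phi p h w = prodPhi s w) /\
  (forall k w, grad_rv p h k w = dprodPhi k s w).
Proof.
exists (size s), (fun i => nth 0 s i).
have [p] := prodPhi_poly (fun i : 'I_(size s) => nth 0 s i) (enum 'I_(size s)).
rewrite (_ : [seq _ | i <- _] = s); first by exists p.
by rewrite -[RHS](mkseq_nth 0) /mkseq -val_enum_ord -map_comp.
Qed.

End polynomials.

Section linear_spans.
Context (R : realType).

Lemma pair_sum (U V : lmodType R) (I : Type) (r : seq I) (f : I -> U) (g : I -> V) :
  (\sum_(i <- r) f i, \sum_(i <- r) g i) = \sum_(i <- r) (f i, g i) :> U * V.
Proof. by elim: r => [|i r IHr]; rewrite ?big_nil// !big_cons -IHr. Qed.

Lemma formally_adjoint_span (U V : preHilbertType R) (A : set (U * V))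
    (B : set (V * U)) :
  (forall z w, A z -> B w -> inner z.2 w.1 = inner z.1 w.2) ->
  formally_adjoint (linear_span A) (linear_span B).
Proof.
move=> AB x Ax y By.
pose Q := [set z : U * V | forall w, linear_span B w -> inner z.2 w.1 = inner z.1 w.2].
suff AQ : linear_span A `<=` Q by move=> /AQ h /h.
apply: linear_span_min => [|z Az w].
  split=> [w _|a z z' Qz Qz' w Bw] /=; first by rewrite !inner0l.
  by rewrite !innerDl !innerZl Qz// Qz'.
pose Q' := [set w : V * U | inner z.2 w.1 = inner z.1 w.2].
suff BQ : linear_span B `<=` Q' by exact: BQ.
apply: linear_span_min => [|w' Bw']; last exact: AB.
split=> [|a w1 w2]; first by rewrite /Q' /= !inner0r.
by rewrite /Q' /= => Q1 Q2; rewrite !innerDr !innerZr Q1 Q2.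
Qed.

Lemma linear_span_fst (U V : lmodType R) (A : set (U * V)) (D : set U) :
  linear_subspace D -> (forall z, A z -> D z.1) ->
  forall x y, linear_span A (x, y) -> D x.
Proof.
move=> [D0 DP] AD x y h.
suff : linear_span A `<=` [set z | D z.1] by move=> /(_ _ h).
by apply: linear_span_min => //; split=> // a z z'; exact: DP.
Qed.

Lemma linear_span_snd (U V : lmodType R) (A : set (U * V)) (D : set V) :
  linear_subspace D -> (forall z, A z -> D z.2) ->
  forall x y, linear_span A (x, y) -> D y.
Proof.
move=> [D0 DP] AD x y h.
suff : linear_span A `<=` [set z | D z.2] by move=> /(_ _ h).
by apply: linear_span_min => //; split=> // a z z'; exact: DP.
Qed.

End linear_spans.

(** * The two operators expressed on monomials *)

Section graphs.
Context (R : realType) (L : hilbertType R).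
Context d (T : measurableType d) (P : probability T R).
Context (Phi : L -> LspaceType2 P) (hPhi : gaussian_field Phi).
Local Notation prodPhi := (prodPhi Phi).
Local Notation dprodPhi := (dprodPhi Phi).
Local Notation L2 := (LspaceType2 P).

Lemma L2_comb_ae (J : Type) (r : seq J) (a : J -> R) (F : J -> L2) (f : J -> T -> R) :
  (forall i, (F i : T -> R) = f i %[ae P]) ->
  ((\sum_(i <- r) a i *: F i : L2) : T -> R) =
  (fun x => \sum_(i <- r) a i * f i x) %[ae P].
Proof.
move=> Ff; elim: r => [|i r IHr].
  by rewrite big_nil; apply: filterS (L2_0E P) => x /(_ I) -> _; rewrite big_nil.
rewrite big_cons.
apply: filterS3 (L2_linE_ae (a i) (F i) (\sum_(j <- r) a j *: F j)) (Ff i) IHr.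
by move=> x /(_ I) -> /(_ I) -> /(_ I) -> _; rewrite big_cons.
Qed.

Definition monomial (s : seq L) : L2 :=
  L2_of (Lfun_Sub (lee1n 2) (growth_Lfun hPhi (growth_prodPhi Phi s))).

Lemma monomialE s : (monomial s : T -> R) = prodPhi s %[ae P].
Proof. exact: L2_ofE. Qed.

Lemma monomial_comb_ae (cs : seq (R * seq L)) :
  ((\sum_(c <- cs) c.1 *: monomial c.2 : L2) : T -> R) =
  (fun x => \sum_(c <- cs) c.1 * prodPhi c.2 x) %[ae P].
Proof. by apply: L2_comb_ae => c; exact: monomialE. Qed.

(** Index set of the Leibniz rule: entries are split off by position, so a repeated vector counts
    with its multiplicity. *)
Fixpoint removals (s : seq L) : seq (L * seq L) :=
  if s is g :: s' then (g, s') :: [seq (p.1, g :: p.2) | p <- removals s'] else [::].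

Lemma dprodPhi_removals k s x :
  dprodPhi k s x = \sum_(p <- removals s) inner p.1 k * prodPhi p.2 x.
Proof.
elim: s => [|g s IHs] /=; first by rewrite big_nil.
rewrite big_cons big_map /= IHs mulr_sumr; congr (_ + _).
by apply: eq_bigr => p _; rewrite prodPhi_cons mulrCA.
Qed.

(** Euler's identity for a homogeneous polynomial of degree [size s], the source of the eigenvalue
    of S T. *)
Lemma removals_prodPhi s x :
  \sum_(p <- removals s) prodPhi (p.1 :: p.2) x = (size s)%:R * prodPhi s x.
Proof.
elim: s => [|g s IHs] /=; first by rewrite big_nil mul0r.
rewrite big_cons big_map /= -natr1 mulrDl mul1r addrC; congr (_ + _).
rewrite (eq_bigr (fun p => Phi g x * prodPhi (p.1 :: p.2) x)) => [|p _].
  by rewrite -mulr_sumr IHs prodPhi_cons mulrCA.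
by rewrite !prodPhi_cons mulrCA.
Qed.

Lemma size_removals p s : p \in removals s -> (size p.2).+1 = size s.
Proof.
elim: s p => [|g s IHs] p //=; rewrite inE => /predU1P[->//|/mapP[q qs ->]] /=.
by rewrite IHs.
Qed.

Definition dmonomial (k : L) (s : seq L) : L2 :=
  \sum_(p <- removals s) inner p.1 k *: monomial p.2.

Lemma dmonomialE k s : (dmonomial k s : T -> R) = dprodPhi k s %[ae P].
Proof.
have h := L2_comb_ae (removals s) (fun p => inner p.1 k) (fun p => monomialE p.2).
by apply: filterS h => x /(_ I) -> _; rewrite dprodPhi_removals.
Qed.

(** Integration by parts for the monomial of [s ++ t], then the Leibniz rule. It says that
    multiplication by Phi k minus D_k is formally adjoint to D_k. *)
Lemma inner_monomial_cons k s t : inner (monomial s) (monomial (k :: t)) =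
  inner (dmonomial k s) (monomial t) + inner (monomial s) (dmonomial k t).
Proof.
have ms u := growth_measurable (growth_prodPhi Phi u).
have md u := growth_measurable (growth_dprodPhi Phi k u).
rewrite (innerE (ms _) (ms _) (monomialE s) (monomialE (k :: t))).
rewrite (innerE (md _) (ms _) (dmonomialE k s) (monomialE t)).
rewrite (innerE (ms _) (md _) (monomialE s) (dmonomialE k t)).
rewrite -RintegralD//; last 2 first.
- by apply: (growth_integrable hPhi); apply: growthM;
    [exact: growth_dprodPhi|exact: growth_prodPhi].
- by apply: (growth_integrable hPhi); apply: growthM;
    [exact: growth_prodPhi|exact: growth_dprodPhi].
transitivity (\int[P]_x dprodPhi k (s ++ t) x)%R.
  rewrite -(integration_by_parts hPhi).
  by apply: eq_mean => x; rewrite prodPhi_cons prodPhi_cat mulrCA.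
by apply: eq_mean => x; rewrite dprodPhi_cat.
Qed.

Context (H2 : hilbertType R) (tens : {bilinear L2 -> L -> H2}).
Hypothesis htens : hilbert_tensor tens.

Lemma tens_comb (I : Type) (r : seq I) (a : I -> R) (F : I -> L2) k :
  tens (\sum_(i <- r) a i *: F i) k = \sum_(i <- r) a i *: tens (F i) k.
Proof.
elim: r => [|i r IHr]; first by rewrite !big_nil linear0l.
by rewrite !big_cons linearDl linearZl -IHr.
Qed.

Definition Dmonomial (s : seq L) : H2 :=
  \sum_(p <- removals s) tens (monomial p.2) p.1.

(** A version of the graph whose generators are explicit, so that its properties become statements
    about lists; [malliavin_eq] identifies it with the original one. *)
Definition malliavin_monomials : set (L2 * H2) :=
  linear_span [set z | exists s, z = (monomial s, Dmonomial s)].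

Definition integral_monomials : set (H2 * L2) :=
  linear_span [set z | exists s k,
    z = (tens (monomial s) k, monomial (k :: s) - dmonomial k s)].

Local Notation T0 := malliavin_monomials.
Local Notation S0 := integral_monomials.

Let sT0 : linear_subspace T0. Proof. exact: linear_span_subspace. Qed.
Let sS0 : linear_subspace S0. Proof. exact: linear_span_subspace. Qed.

Lemma T0_monomial s : T0 (monomial s, Dmonomial s).
Proof. by apply: sub_linear_span; exists s. Qed.

Lemma S0_monomial s k : S0 (tens (monomial s) k, monomial (k :: s) - dmonomial k s).
Proof. by apply: sub_linear_span; exists s, k. Qed.

Lemma dom_S0_tens (cs : seq (R * seq L)) k :
  dom S0 (tens (\sum_(c <- cs) c.1 *: monomial c.2) k).
Proof.
rewrite tens_comb; apply: subspace_sum => [|c _]; first exact: subspace_dom.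
apply: subspaceZ; first exact: subspace_dom.
by exists (monomial (k :: c.2) - dmonomial k c.2); exact: S0_monomial.
Qed.

Lemma inner_Dmonomial s t k :
  inner (Dmonomial s) (tens (monomial t) k) = inner (dmonomial k s) (monomial t).
Proof.
rewrite /Dmonomial /dmonomial !inner_suml; apply: eq_bigr => p _.
by rewrite htens.1 innerZl mulrC.
Qed.

Lemma formally_adjoint_T0_S0 : formally_adjoint T0 S0.
Proof.
apply: formally_adjoint_span => _ _ [s ->] [t [k ->]] /=.
by rewrite inner_Dmonomial innerBr inner_monomial_cons addrK.
Qed.

Lemma ran_T0 x y : T0 (x, y) -> dom S0 y.
Proof.
apply: linear_span_snd => [|_ [s ->]] /=; first exact: subspace_dom.
apply: subspace_sum => [|p _]; first exact: subspace_dom.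
by exists (monomial (p.1 :: p.2) - dmonomial p.1 p.2); exact: S0_monomial.
Qed.

Let dom_T0_monomial s : dom T0 (monomial s).
Proof. by exists (Dmonomial s); exact: T0_monomial. Qed.

Let dom_T0_dmonomial k s : dom T0 (dmonomial k s).
Proof.
apply: subspace_sum => [|p _]; first exact: subspace_dom.
by apply: subspaceZ; first exact: subspace_dom.
Qed.

Lemma ran_S0 x y : S0 (x, y) -> dom T0 y.
Proof.
apply: linear_span_snd => [|_ [s [k ->]]] /=; first exact: subspace_dom.
by apply: subspaceB => //; exact: subspace_dom.
Qed.

(** The difference x - y is itself a combination of the test tensors, hence orthogonal to itself.
    Equalities in [H2] are thereby reduced to scalar ones without any normal form for tensors. *)
Lemma dom_S0_eq x y : dom S0 x -> dom S0 y ->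
  (forall s k, inner x (tens (monomial s) k) = inner y (tens (monomial s) k)) ->
  x = y.
Proof.
move=> dx dy xy; apply/eqP; rewrite -subr_eq0; apply/eqP/inner_eq0.
have [w hw] : dom S0 (x - y) by apply: subspaceB => //; exact: subspace_dom.
apply: (linear_span_fst (D := [set v | inner (x - y) v = 0]) _ _ hw).
  split=> /= [|a u v]; first by rewrite inner0r.
  by rewrite innerDr innerZr => -> ->; rewrite mulr0 addr0.
by move=> _ [s [k ->]] /=; rewrite innerBl xy subrr.
Qed.

(* Each monomial is an eigenvector of S T for its degree, up to monomials of
   lower degree. *)
Lemma resolvent_T0_S0 x : dom T0 x ->
  exists w Aw u, [/\ T0 (w, Aw), S0 (Aw, u) & x = w + u].
Proof.
pose Q := [set x | exists w Aw u, [/\ T0 (w, Aw), S0 (Aw, u) & x = w + u]].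
have sQ : linear_subspace Q.
  split; first by exists 0, 0, 0; split; [case: sT0|case: sS0|rewrite addr0].
  move=> a _ _ [w [Aw [u [h1 h2 ->]]]] [w' [Aw' [u' [h1' h2' ->]]]].
  exists (a *: w + w'), (a *: Aw + Aw'), (a *: u + u'); split.
  - exact: (sT0.2 a (_, _) (_, _)).
  - exact: (sS0.2 a (_, _) (_, _)).
  - by rewrite scalerDr addrACA.
suff mQ s : Q (monomial s).
  by move=> [y]; apply: (linear_span_fst sQ) => _ [s ->]; exact: mQ.
have [n] := ubnP (size s); elim: n s => // n IHn s; rewrite ltnS => sn.
(* Its monomials have lost two entries of [s], so the induction covers them. *)
pose low := \sum_(p <- removals s) dmonomial p.1 p.2.
have Qlow : Q low.
  rewrite /low big_seq; apply: subspace_sum => // p /size_removals ps.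
  rewrite /dmonomial big_seq; apply: subspace_sum => // q /size_removals qs.
  apply: subspaceZ => //; apply: IHn; apply: leq_trans sn.
  by rewrite -ps -qs ltnS leqnSn.
pose a : R := (size s).+1%:R^-1.
have SD : S0 (Dmonomial s, (size s)%:R *: monomial s - low).
  have -> : (size s)%:R *: monomial s - low =
      \sum_(p <- removals s) (monomial (p.1 :: p.2) - dmonomial p.1 p.2).
    rewrite sumrB; congr (_ - _).
    apply: (L2_eq_of_ae (f := fun x => (size s)%:R * prodPhi s x)).
      apply: filterS2 (L2_scaleE (size s)%:R (monomial s)) (monomialE s).
      by move=> t /(_ I) -> /(_ I) ->.
    have h := L2_comb_ae (removals s) (fun=> 1) (fun p => monomialE (p.1 :: p.2)).
    under eq_bigr do rewrite -[monomial _]scale1r.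
    apply: filterS h => t /(_ I) -> _; rewrite -removals_prodPhi.
    by apply: eq_bigr => p _; rewrite mul1r.
  rewrite /Dmonomial pair_sum; apply: subspace_sum => // p _; exact: S0_monomial.
(* Here 1 + S T sends [a *: monomial s] to [monomial s - a *: low], as [a] is the inverse of 1 +
   size s. *)
rewrite (_ : monomial s = (a *: monomial s +
    a *: ((size s)%:R *: monomial s - low)) + a *: low).
  apply: subspaceD => //; last exact: subspaceZ.
  exists (a *: monomial s), (a *: Dmonomial s), (a *: ((size s)%:R *: monomial s - low)).
  split=> //; last exact: subspaceZ sS0 SD.
  exact: subspaceZ sT0 (T0_monomial s).
rewrite -addrA -!scalerDr subrK -[X in X + _]scale1r -scalerDl scalerA.
by rewrite addrC natr1 mulVf ?scale1r// pnatr_eq0.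
Qed.

Lemma poly_rv_comb n (p : mpoly.mpoly n R) (h : 'I_n -> L) (F : L2) :
  (F : T -> R) = poly_rv Phi p h %[ae P] ->
  exists2 cs, F = \sum_(c <- cs) c.1 *: monomial c.2 &
    forall k, (\sum_(c <- cs) c.1 *: dmonomial k c.2 : T -> R) = grad_rv Phi p h k %[ae P].
Proof.
move=> Fp; have [cs [e1 e2]] := poly_grad_poly_rv Phi h p; exists cs => [|k].
  apply: L2_eq_of_ae Fp _.
  by apply: filterS (monomial_comb_ae cs) => x /(_ I) -> _; rewrite e1.
have hk := L2_comb_ae cs (fun c => c.1) (fun c => dmonomialE k c.2).
by apply: filterS hk => x /(_ I) -> _; rewrite e2.
Qed.

Let dom_S0_gradient n (p : mpoly.mpoly n R) (h : 'I_n -> L) (D : 'I_n -> L2) :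
  (forall j, (D j : T -> R) = poly_rv Phi (mpoly.mderiv j p) h %[ae P]) ->
  dom S0 (\sum_(j < n) tens (D j) (h j)).
Proof.
move=> hD; apply: subspace_sum => [|j _]; first exact: subspace_dom.
by have [cs -> _] := poly_rv_comb (hD j); exact: dom_S0_tens.
Qed.

Let inner_gradient n (p : mpoly.mpoly n R) (h : 'I_n -> L) (D : 'I_n -> L2)
    (G : L2) t k :
  (forall j, (D j : T -> R) = poly_rv Phi (mpoly.mderiv j p) h %[ae P]) ->
  (G : T -> R) = grad_rv Phi p h k %[ae P] ->
  inner (\sum_(j < n) tens (D j) (h j)) (tens (monomial t) k) = inner G (monomial t).
Proof.
move=> hD hG; have -> : G = \sum_(j < n) inner (h j) k *: D j.
  apply: L2_eq_of_ae hG _.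
  have e := L2_comb_ae (index_enum 'I_n) (fun j => inner (h j) k) hD.
  apply: filterS e => x /(_ I) -> _.
  by apply: eq_bigr => j _; rewrite mulrC.
rewrite !inner_suml; apply: eq_bigr => j _.
by rewrite htens.1 innerZl mulrC.
Qed.

(** First components agree by expansion into monomials. The second ones are compared through
    [dom_S0_eq]: paired with a tensor in direction k, both gradients reduce to the directional
    derivative along k. *)
Lemma malliavin_eq : malliavin Phi tens = T0.
Proof.
apply/seteqP; split; apply: linear_span_min; rewrite ?/T0//; try exact: linear_span_subspace.
  move=> [F X] /= [n [p [h [D [Fp hD ->]]]]].
  have [cs defF gradF] := poly_rv_comb Fp.
  rewrite (_ : (F, _) = \sum_(c <- cs) c.1 *: (monomial c.2, Dmonomial c.2)).
    apply: subspace_sum => // c _; apply: subspaceZ => //; exact: T0_monomial.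
  rewrite -pair_sum -defF; congr pair; apply: dom_S0_eq.
  - exact: dom_S0_gradient hD.
  - apply: subspace_sum => [|c _]; first exact: subspace_dom.
    apply: subspaceZ; first exact: subspace_dom.
    exact: ran_T0 (T0_monomial c.2).
  move=> t k; rewrite (inner_gradient t hD (gradF k)) !inner_suml.
  by apply: eq_bigr => c _; rewrite !innerZl inner_Dmonomial.
move=> _ [s ->]; apply: sub_linear_span => /=.
have [n [h [p [e1 e2]]]] := prodPhi_poly_rv Phi s.
have /choice[D hD] : forall j : 'I_n, exists F : L2,
    (F : T -> R) = poly_rv Phi (mpoly.mderiv j p) h %[ae P].
  move=> j; have [cs [e _]] := poly_grad_poly_rv Phi h (mpoly.mderiv j p).
  exists (\sum_(c <- cs) c.1 *: monomial c.2).
  by apply: filterS (monomial_comb_ae cs) => x /(_ I) -> _; rewrite e.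
exists n, p, h, D; split=> //.
  by apply: filterS (monomialE s) => x /(_ I) -> _; rewrite e1.
apply: dom_S0_eq; [exact: ran_T0 (T0_monomial s)|exact: dom_S0_gradient hD|].
move=> t k; rewrite inner_Dmonomial (inner_gradient (G := dmonomial k s) t hD)//.
by apply: filterS (dmonomialE k s) => x /(_ I) -> _; rewrite e2.
Qed.

Lemma stochastic_integral_eq : stochastic_integral Phi tens = S0.
Proof.
apply/seteqP; split; apply: linear_span_min; try exact: linear_span_subspace.
  move=> [X z] /= [n [p [h [F [k [Fp -> hz]]]]]].
  have [cs defF gradF] := poly_rv_comb Fp.
  rewrite (_ : (_, z) = \sum_(c <- cs) c.1 *:
      (tens (monomial c.2) k, monomial (k :: c.2) - dmonomial k c.2)).
    apply: subspace_sum => // c _; apply: subspaceZ => //; exact: S0_monomial.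
  rewrite -pair_sum [in LHS]defF tens_comb; congr pair.
  under eq_bigr do rewrite scalerBr.
  rewrite sumrB; apply: L2_eq_of_ae hz _; apply: L2_subE_ae; last exact: gradF.
  have h1 := L2_comb_ae cs (fun c => c.1) (fun c => monomialE (k :: c.2)).
  have h2 := monomial_comb_ae cs.
  rewrite -defF in h2.
  apply: filterS3 h1 h2 Fp => x /(_ I) -> /(_ I) e /(_ I) <- _; rewrite e mulr_suml.
  by apply: eq_bigr => c _; rewrite prodPhi_cons; ring.
move=> _ [s [k ->]]; apply: sub_linear_span => /=.
have [n [h [p [e1 e2]]]] := prodPhi_poly_rv Phi s.
exists n, p, h, (monomial s), k; split=> //.
  by apply: filterS (monomialE s) => x /(_ I) -> _; rewrite e1.
have := L2_subE_ae (monomialE (k :: s)) (dmonomialE k s).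
apply: filterS => x /(_ I) -> _.
by rewrite prodPhi_cons -e1 -e2 mulrC.
Qed.

End graphs.

(** * Density of the polynomials *)

Section sign_iteration.
Context (R : realType).
Implicit Types y s : R.

(* Newton's iteration for the sign of a number in [-1, 1]. *)
Definition sign_step s := s * (3 - s ^+ 2) / 2.

Lemma sign_iterN n y : iter n sign_step (- y) = - iter n sign_step y.
Proof. by elim: n => //= n ->; rewrite /sign_step; field. Qed.

(** A step multiplies the error 1 - s by (2 - s - s^2) / 2, which is at most 1 - y / 2 because the
    iterates never drop below y. *)
Lemma sign_iter_bounds n y : 0 < y <= 1 ->
  y <= iter n sign_step y <= 1 /\ 1 - iter n sign_step y <= (1 - y / 2) ^+ n.
Proof.
move=> /andP[y0 y1]; elim: n => [|n [/andP[ys s1] IHn]] /=.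
  by rewrite lexx y1 expr0; split=> //; lra.
set s := iter n sign_step y in ys s1 IHn *.
have E : 1 - sign_step s = (1 - s) * ((2 - s - s ^+ 2) / 2).
  by rewrite /sign_step; field.
have E' : sign_step s - s = s * ((1 - s) * (1 + s) / 2).
  by rewrite /sign_step; field.
have s0 : 0 < s by exact: lt_le_trans ys.
have s2 : 0 <= s ^+ 2 by exact: sqr_ge0.
split.
  apply/andP; split.
    rewrite (le_trans ys)// -subr_ge0 E' mulr_ge0 ?(ltW s0)//.
    by rewrite divr_ge0// mulr_ge0 ?subr_ge0// addr_ge0// ltW.
  rewrite -subr_ge0 E mulr_ge0 ?subr_ge0// divr_ge0//.
  by have : s ^+ 2 <= 1 by [rewrite expr_le1// ltW]; lra.
rewrite E [leRHS]exprSr; apply: ler_pM => //.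
- by rewrite subr_ge0.
- by rewrite divr_ge0//; have : s ^+ 2 <= 1 by [rewrite expr_le1// ltW]; lra.
- lra.
Qed.

Lemma norm_sign_iter n y : `|y| <= 1 -> `|iter n sign_step y| <= 1.
Proof.
move=> y1; have [->|y0] := eqVneq y 0.
  have -> : iter n sign_step 0 = 0.
    by elim: n => //= n ->; rewrite /sign_step !mul0r.
  by rewrite normr0.
wlog y_gt0 : y y1 y0 / 0 < y => [hw|].
  have [/hw|] := ltP 0 y; first exact.
  rewrite le_eqVlt (negbTE y0)/= -oppr_gt0 => Ny.
  by rewrite -normrN -sign_iterN hw ?normrN ?oppr_eq0.
have y01 : 0 < y <= 1 by rewrite y_gt0 -(gtr0_norm y_gt0).
have [/andP[h1 h2] _] := sign_iter_bounds n y01.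
by rewrite ger0_norm// (le_trans _ h1)// ltW.
Qed.

Lemma cvg_sign_iter y : `|y| <= 1 -> iter n sign_step y @[n --> \oo] --> Num.sg y.
Proof.
have pos z : 0 < z <= 1 -> iter n sign_step z @[n --> \oo] --> (1 : R).
  move=> z01; have [z0 z1] := andP z01.
  have g : (1 - z / 2) ^+ n @[n --> \oo] --> (0 : R).
    by apply: cvg_expr; rewrite ger0_norm; lra.
  apply: (@squeeze_cvgr _ _ _ _ (fun n => 1 - (1 - z / 2) ^+ n) (fun=> 1)).
  - apply: nearW => n; have [/andP[_ ->] h] := sign_iter_bounds n z01.
    by rewrite andbT lerBlDr addrC -lerBlDr.
  - by rewrite -[X in _ --> X]subr0; apply: cvgB => //; exact: cvg_cst.
  - exact: cvg_cst.
move=> y1; have [y0|y0|->] := ltgtP y 0.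
- have yN : 0 < - y <= 1 by rewrite oppr_gt0 y0 -(ltr0_norm y0).
  rewrite ltr0_sg// (_ : (fun n => iter n sign_step y) =
      fun n => - iter n sign_step (- y)).
    by apply: cvgN; exact: pos.
  by apply/funext => n; rewrite sign_iterN opprK.
- by rewrite gtr0_sg//; apply: pos; rewrite y0 -(gtr0_norm y0).
- rewrite sgr0 (_ : (fun n => iter n sign_step 0) = fun=> 0); first exact: cvg_cst.
  by apply/funext; elim=> //= n ->; rewrite /sign_step !mul0r.
Qed.

End sign_iteration.

(** * The algebra of bounded multipliers of a closed subspace *)

Section multipliers.
Context d (T : measurableType d) (R : realType) (P : probability T R).
Local Notation L2 := (LspaceType2 P).
Context (C : set L2) (sC : linear_subspace C) (cC : closed C).

Definition multiplier (g : T -> R) :=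
  [/\ measurable_fun [set: T] g, exists M, forall x, `|g x| <= M &
      forall F, C F -> exists2 G, C G & (G : T -> R) = (fun x => g x * F x) %[ae P]].

Lemma Lfun_bounded_mul (g : T -> R) M (F : L2) : measurable_fun [set: T] g ->
  (forall x, `|g x| <= M) -> (fun x => g x * F x) \in Lfun P 2%:E.
Proof.
move=> mg gM; have mF := L2_measurable F; apply: Lfun2_of_sqr.
  exact: measurable_funM.
have := integrableZl measurableT (M ^+ 2) (Lfun2_integrable_sqr (L2_Lfun F)).
apply: le_integrable => //.
  by apply/measurable_EFinP; apply: measurable_funX; exact: measurable_funM.
move=> x _ /=; rewrite lee_fin -[X in _ <= `|X|]exprMn !normrX.
rewrite lerXn2r ?nnegrE// !normrM ler_wpM2r//.
by rewrite (le_trans (gM x))// ler_norm.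
Qed.

Lemma norm_bounded_mul (g : T -> R) M (F G : L2) : measurable_fun [set: T] g ->
  (forall x, `|g x| <= M) -> (G : T -> R) = (fun x => g x * F x) %[ae P] ->
  `|G| <= M * `|F|.
Proof.
(* A negative bound is contradicted at the base point of the sample space. *)
move=> mg gM Gg; have [M0|M0] := ltP M 0.
  by have := le_lt_trans (gM point) M0; rewrite ltNge normr_ge0.
rewrite -ler_sqr ?nnegrE ?mulr_ge0// exprMn -!inner_norm.
have mF := L2_measurable F; have mgF := measurable_funM mg mF.
rewrite (innerE mgF mgF Gg Gg) (innerE mF mF (ae_eq_refl P setT (F : T -> R))
  (ae_eq_refl P setT (F : T -> R))).
have iF : P.-integrable setT (EFin \o (fun x => F x * F x)).
  exact/Lfun1_integrable/Lfun2_mul_Lfun1/L2_Lfun/L2_Lfun.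
rewrite -RintegralZl//; apply: le_Rintegral => //.
- by apply/Lfun1_integrable/Lfun2_mul_Lfun1; exact: Lfun_bounded_mul mg gM.
- have := integrableZl measurableT (M ^+ 2) iF.
  by apply: eq_integrable => // x _; rewrite /= EFinM.
move=> x _; rewrite mulrACA -!expr2 ler_wpM2r ?sqr_ge0//.
by rewrite -[leLHS]real_normK ?num_real// lerXn2r ?nnegrE.
Qed.

(** Multiplication by a bounded function is continuous in mean square, so it suffices to test it on
    a set whose closure contains C. *)
Lemma multiplier_of_dense (A : set L2) (g : T -> R) M : C `<=` closure A ->
  measurable_fun [set: T] g -> (forall x, `|g x| <= M) ->
  (forall F, A F -> exists2 G, C G & (G : T -> R) = (fun x => g x * F x) %[ae P]) ->
  multiplier g.
Proof.
move=> CA mg gM gA; split=> //; first by exists M.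
move=> F /CA /closure_ball AF.
have [G Gg] := L2_exists (Lfun_bounded_mul F mg gM); exists G => //.
apply: cC; apply/closure_ball => e e0.
have M1 : 0 < `|M| + 1 by rewrite ltr_wpDl.
have [F' AF' FF'] := AF _ (divr_gt0 e0 M1).
have [G' CG' G'g] := gA _ AF'; exists G' => //.
have GG' : ((G - G' : L2) : T -> R) = (fun x => g x * (F - F') x) %[ae P].
  have h := L2_subE_ae Gg G'g.
  have h' := L2_subE_ae (ae_eq_refl P setT (F : T -> R)) (ae_eq_refl P setT (F' : T -> R)).
  by apply: filterS2 h h' => x /(_ I) -> /(_ I) -> _; rewrite mulrBr.
apply: le_lt_trans (norm_bounded_mul mg gM GG') _.
apply: (@le_lt_trans _ _ ((`|M| + 1) * `|F - F'|)).
  by rewrite ler_wpM2r// (le_trans (ler_norm M))// lerDl.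
by rewrite mulrC -ltr_pdivlMr.
Qed.

Lemma multiplier_cst c : multiplier (fun=> c).
Proof.
split=> //; first by exists `|c|.
by move=> F CF; exists (c *: F); [exact: subspaceZ|exact: L2_scaleE].
Qed.

Lemma multiplierD f g : multiplier f -> multiplier g ->
  multiplier (fun x => f x + g x).
Proof.
move=> [mf [M fM] fC] [mg [N gN] gC]; split; first exact: measurable_funD.
  by exists (M + N) => x; rewrite (le_trans (ler_normD _ _))// lerD.
move=> F CF; have [G CG Gf] := fC _ CF; have [H CH Hg] := gC _ CF.
exists (G + H); first exact: subspaceD.
have h := L2_addE G H.
by apply: filterS3 h Gf Hg => x /(_ I) -> /(_ I) -> /(_ I) -> _; rewrite mulrDl.
Qed.

Lemma multiplierM f g : multiplier f -> multiplier g ->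
  multiplier (fun x => f x * g x).
Proof.
move=> [mf [M fM] fC] [mg [N gN] gC]; split; first exact: measurable_funM.
  by exists (M * N) => x; rewrite normrM ler_pM.
move=> F CF; have [G CG Gg] := gC _ CF; have [H CH Hf] := fC _ CG.
exists H => //; apply: filterS2 Hf Gg => x /(_ I) -> /(_ I) -> _.
by rewrite mulrA.
Qed.

Lemma multiplier_lim (g_ : nat -> T -> R) (g : T -> R) M :
  (forall n, multiplier (g_ n)) -> (forall n x, `|g_ n x| <= M) ->
  (forall x, g_ ^~ x @ \oo --> g x) -> multiplier g.
Proof.
move=> mult_g gM gg; have mg_ n : measurable_fun [set: T] (g_ n) by case: (mult_g n).
have mg : measurable_fun [set: T] g by apply: measurable_fun_cvg mg_ _ => x _.
have g_le x : `|g x| <= M.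
  apply: (ler_cvg_to (cvg_norm (gg x)) (cvg_cst M)).
  by apply: nearW => n; exact: gM.
split=> //; first by exists M.
move=> F CF; have mF := L2_measurable F.
have [G Gg] := L2_exists (Lfun_bounded_mul F mg g_le); exists G => //.
apply: cC; apply: (@dominated_closure _ _ _ _ C G (fun n x => g_ n x * F x)
  (fun x => g x * F x) (fun x => `|M * F x|)) => //.
- by move=> n; exact: measurable_funM.
- exact: measurable_funM.
- by move=> n; have [_ _ /(_ _ CF)] := mult_g n.
- apply: Lfun2_of_sqr.
    by apply: measurableT_comp => //; exact: measurable_funM.
  have := integrableZl measurableT (M ^+ 2) (Lfun2_integrable_sqr (L2_Lfun F)).
  by apply: eq_integrable => // x _; rewrite /= -EFinM real_normK ?num_real// exprMn.
- move=> n x; rewrite !normrM ler_wpM2r//.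
  by rewrite (le_trans (gM n x))// ler_norm.
- by move=> x; apply: cvgM; [exact: gg|exact: cvg_cst].
Qed.

Lemma multiplier_ae (f g : T -> R) M : multiplier f -> measurable_fun [set: T] g ->
  (forall x, `|g x| <= M) -> f = g %[ae P] -> multiplier g.
Proof.
move=> [mf _ fC] mg gM fg; split=> //; first by exists M.
move=> F CF; have [G CG Gf] := fC _ CF; exists G => //.
by apply: filterS2 Gf fg => x /(_ I) -> /(_ I) -> _.
Qed.

(** The iterates are polynomials in g bounded by 1 and converging to its sign everywhere; this
    explicit iteration takes the place of a Weierstrass approximation. *)
Lemma multiplier_sg g : multiplier g -> (forall x, `|g x| <= 1) ->
  multiplier (fun x => Num.sg (g x)).
Proof.
move=> mg g1; apply: (@multiplier_lim (fun n x => iter n (@sign_step R) (g x)) _ 1).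
- elim=> [|n IHn] //=; rewrite /sign_step.
  apply: multiplierM; last exact: multiplier_cst.
  apply: multiplierM => //; apply: multiplierD; first exact: multiplier_cst.
  under eq_fun do rewrite expr2 -mulNr -mulN1r.
  by apply: multiplierM => //; apply: multiplierM => //; exact: multiplier_cst.
- by move=> n x; exact: norm_sign_iter.
- by move=> x; exact: cvg_sign_iter.
Qed.

Lemma multiplier_indic_gt0 g : multiplier (fun x => Num.sg (g x)) ->
  multiplier \1_[set x | 0 < g x].
Proof.
(* The polynomial (s^2 + s) / 2 sends the signs 1, 0, -1 to 1, 0, 0. *)
move=> mg; rewrite (_ : \1__ = fun x => (Num.sg (g x) * Num.sg (g x) + Num.sg (g x)) * 2^-1).
  apply: multiplierM; last exact: multiplier_cst.
  by apply: multiplierD => //; exact: multiplierM.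
apply/funext => x; rewrite indicE; have [x0|x0|x0] := ltgtP (g x) 0.
- rewrite memNset/= ?ltr0_sg//; last by apply/negP; rewrite -leNgt ltW.
  by field.
- by rewrite mem_set//= gtr0_sg//; field.
- rewrite memNset/= x0 ?sgr0; last by rewrite ltxx.
  by field.
Qed.

(** Since multipliers can be multiplied, arbitrary countable unions are reached directly, without
    disjointness: the indicator of a union is the bounded limit of 1 - prod_(i < n) (1 -
    1_(A_i)). *)
Lemma sigma_algebra_multiplier : sigma_algebra [set: T] [set A | multiplier \1_A].
Proof.
split=> /=.
- by rewrite indic0; exact: multiplier_cst.
- move=> A mA; rewrite (_ : \1__ = fun x => 1 + (-1) * \1_A x).
    by apply: multiplierD; [|apply: multiplierM]; rewrite //; exact: multiplier_cst.
  apply/funext => x; rewrite !indicE in_setD in_setT/=.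
  by case: (x \in A); rewrite /= ?mulr1 ?mulr0 ?subrr ?addr0 ?addrN.
move=> A mA.
pose a i x : R := 1 + (-1) * \1_(A i) x.
pose g n x : R := 1 + (-1) * \prod_(i < n) a i x.
have aE i x : a i x = (x \notin A i)%:R.
  rewrite /a indicE; case: (x \in A i).
    by rewrite mulr1 addrN.
  by rewrite mulr0 addr0.
have ma i : multiplier (a i).
  by apply: multiplierD; [|apply: multiplierM]; rewrite //; exact: multiplier_cst.
apply: (@multiplier_lim g _ 1).
- move=> n; apply: multiplierD; first exact: multiplier_cst.
  apply: multiplierM; first exact: multiplier_cst.
  elim: n => [|n IHn]; first by under eq_fun do rewrite big_ord0; exact: multiplier_cst.
  by under eq_fun do rewrite big_ord_recr/=; exact: multiplierM.
- move=> n x; rewrite /g.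
  have a01 i : 0 <= a i x <= 1 by rewrite aE ler0n lern1 leq_b1.
  have p0 : 0 <= \prod_(i < n) a i x by rewrite prodr_ge0// => i _; case/andP: (a01 i).
  have p1 : \prod_(i < n) a i x <= 1 by rewrite prodr_ile1.
  by rewrite mulN1r ger0_norm; lra.
- move=> x; have [[i _ Aix]|NA] := pselect ((\bigcup_k A k) x).
    rewrite indicE mem_set; last by exists i.
    apply: cvg_near_cst; exists i.+1 => // n /= ni.
    rewrite /g (bigD1 (Ordinal ni))//= aE mem_set//= mul0r mulr0 addr0.
    by [].
  rewrite indicE memNset// (_ : g ^~ x = fun=> 0); first exact: cvg_cst.
  apply/funext => n; rewrite /g big1 ?mulr1 ?addrN// => i _.
  by rewrite aE memNset//= => Aix; apply: NA; exists i.
Qed.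

End multipliers.

Section bounded_entire.
Context (R : realType).
Implicit Types x t : R.

(** The bound is uniform in [n], so Taylor polynomials evaluated at Phi h share the integrable
    majorant exp|Phi h|. *)
Lemma partial_exp_le (a : nat -> R) x n : (forall i, `|a i| <= i`!%:R^-1) ->
  `|\sum_(i < n) a i * x ^+ i| <= expR `|x|.
Proof.
move=> ha; apply: le_trans (ler_norm_sum _ _ _) _.
apply: (@le_trans _ _ (series (exp_coeff `|x|) n)).
  rewrite /series/= big_mkord; apply: ler_sum => i _.
  by rewrite normrM normrX /exp_coeff/= mulrC ler_wpM2l.
rewrite /expR; apply: nondecreasing_cvgn_le; last exact: is_cvg_series_exp_coeff.
by apply: nondecreasing_series => i _ _; exact: exp_coeff_ge0.
Qed.

Definition sin_taylor (i : nat) : R := (odd i)%:R * (-1) ^+ i.-1./2 * i`!%:R^-1.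
Definition cos_taylor (i : nat) : R := (~~ odd i)%:R * (-1) ^+ i./2 * i`!%:R^-1.

Lemma norm_sin_taylor i : `|sin_taylor i| <= i`!%:R^-1.
Proof.
rewrite /sin_taylor !normrM normrX normrN1 expr1n mulr1 normfV !normr_nat.
by case: odd; rewrite ?mul1r ?mul0r.
Qed.

Lemma norm_cos_taylor i : `|cos_taylor i| <= i`!%:R^-1.
Proof.
rewrite /cos_taylor !normrM normrX normrN1 expr1n mulr1 normfV !normr_nat.
by case: odd; rewrite ?mul1r ?mul0r.
Qed.

Lemma cvg_sin_taylor x : \sum_(i < n) sin_taylor i * x ^+ i @[n --> \oo] --> sin x.
Proof.
rewrite (_ : (fun n => _) = series (sin_coeff x)).
  by rewrite unlock; exact: is_cvg_series_sin_coeff.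
by apply/funext => n; rewrite sin_coeffE /series/= big_mkord.
Qed.

Lemma cvg_cos_taylor x : \sum_(i < n) cos_taylor i * x ^+ i @[n --> \oo] --> cos x.
Proof.
rewrite (_ : (fun n => _) = series (cos_coeff x)).
  by rewrite unlock; exact: is_cvg_series_cos_coeff.
by apply/funext => n; rewrite cos_coeffE /series/= big_mkord.
Qed.

(** The sine is positive on ]0, 2[, so for x > 0 the sign is already 1 once x/(n+1) < 2; negative x
    follow by oddness. *)
Lemma cvg_sg_sin x : Num.sg (sin (n.+1%:R^-1 * x)) @[n --> \oo] --> Num.sg x.
Proof.
have pos y : 0 < y -> Num.sg (sin (n.+1%:R^-1 * y)) @[n --> \oo] --> (1 : R).
  move=> y0; apply: cvg_near_cst.
  have : n.+1%:R^-1 * y @[n --> \oo] --> (0 : R).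
    by rewrite -(mul0r y); apply: cvg_seqM; [exact: cvg_invSn|exact: cvg_seq_cst].
  move=> /cvgr_lt /(_ 2) -/(_ (ltr0n _ 2)); apply: filterS => n yn.
  by rewrite gtr0_sg// sin2_gt0// yn mulr_gt0// invr_gt0.
have [x0|x0|->] := ltgtP x 0; last first.
- under eq_fun do rewrite mulr0 sin0.
  exact: cvg_cst.
- by rewrite gtr0_sg//; exact: pos.
- rewrite ltr0_sg// (_ : (fun n => _) = fun n : nat => - Num.sg (sin (n.+1%:R^-1 * - x))).
    by apply: cvgN; apply: pos; rewrite oppr_gt0.
  by apply/funext => n; rewrite mulrN sinN sgrN opprK.
Qed.

End bounded_entire.

Section multiplier_full.
Context d (T : measurableType d) (R : realType) (P : probability T R).
Local Notation L2 := (LspaceType2 P).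
Context (C : set L2) (sC : linear_subspace C) (cC : closed C).

Import HBNNSimple.

(** Applied to the constant 1, the indicators put all simple functions into C; a nonnegative f is
    their limit dominated by f itself, and a general one is the difference of its positive and
    negative parts. *)
Lemma multipliers_full (one : L2) : C one -> (one : T -> R) = cst 1 %[ae P] ->
  (forall A, measurable A -> multiplier C \1_A) -> forall F, C F.
Proof.
move=> C1 one1 CA.
have pos (f : T -> R) (F : L2) : measurable_fun [set: T] f -> (forall x, 0 <= f x) ->
    f \in Lfun P 2%:E -> (F : T -> R) = f %[ae P] -> C F.
  move=> mf f0 f2 Ff; have mEf : measurable_fun [set: T] (EFin \o f).
    exact/measurable_EFinP.
  pose g := nnsfun_approx measurableT mEf.
  have gf x : g n x @[n --> \oo] --> f x.
    have : (g n x)%:E @[n --> \oo] --> (f x)%:E.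
      by apply: cvg_nnsfun_approx => // y _; rewrite lee_fin.
    exact: fine_cvg.
  apply: cC; apply: (@dominated_closure _ _ _ _ C F g f f) => //.
  - move=> n; have [_ _ /(_ _ C1)[G CG G1]] : multiplier C (g n).
      pose s := finmap.enum_fset (fset_set (g n @` setT)).
      rewrite (_ : (g n : T -> R) = fun x => \sum_(i < size s)
          s`_i * \1_(g n @^-1` [set s`_i]) x); last first.
        by apply/funext => x; rewrite fimfunEord.
      elim: (size s) => [|m IHm].
        by under eq_fun do rewrite big_ord0; exact: multiplier_cst.
      under eq_fun do rewrite big_ord_recr/=; apply: multiplierD => //.
      by apply: multiplierM; [exact: multiplier_cst|exact: CA].
    exists G => //; apply: filterS2 G1 one1 => x /(_ I) -> /(_ I) -> _.
    by rewrite /cst mulr1.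
  - move=> n x; rewrite ger0_norm ?fun_ge0//.
    have nd : nondecreasing_seq (fun m => g m x).
      by move=> m p mp; exact/lefP/nd_nnsfun_approx.
    have := nondecreasing_cvgn_le nd (cvgP _ (gf x)) n.
    by rewrite (cvg_lim _ (gf x)).
move=> F; have mF := L2_measurable F.
have part (f : T -> R) : measurable_fun [set: T] f -> (forall x, `|f x| <= `|F x|) ->
    f \in Lfun P 2%:E.
  move=> mf fF; apply: Lfun2_of_sqr => //.
  apply: le_integrable (Lfun2_integrable_sqr (L2_Lfun F)) => //.
    by apply/measurable_EFinP; exact: measurable_funX.
  by move=> x _ /=; rewrite lee_fin !normrX lerXn2r ?nnegrE.
pose p x := Num.max (F x) 0; pose m x := Num.max (- F x) 0.
have mp : measurable_fun [set: T] p by apply: measurable_maxr.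
have mm : measurable_fun [set: T] m.
  by apply: measurable_maxr => //; exact: measurableT_comp.
have p2 : p \in Lfun P 2%:E.
  by apply: part => // x; rewrite /p; case: (leP (F x) 0) => h; rewrite ?normr0.
have m2 : m \in Lfun P 2%:E.
  by apply: part => // x; rewrite /m; case: (leP (- F x) 0) => h; rewrite ?normr0 ?normrN.
have [Fp hp] := L2_exists p2; have [Fm hm] := L2_exists m2.
have -> : F = Fp - Fm.
  apply: (L2_eq_of_ae (f := F)); first exact: ae_eq_refl.
  apply: filterS (L2_subE_ae hp hm) => x /(_ I) -> _; rewrite /p /m.
  by have [h|h] := leP (F x) 0; have [h'|h'] := leP (- F x) 0; lra.
apply: subspaceB => //.
  by apply: pos hp => // x; rewrite /p le_max lexx orbT.
by apply: pos hm => // x; rewrite /m le_max lexx orbT.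
Qed.

End multiplier_full.

Section density.
Context (R : realType) (L : hilbertType R).
Context d (T : measurableType d) (P : probability T R).
Context (Phi : L -> LspaceType2 P) (hPhi : gaussian_field Phi).
Context (H2 : hilbertType R) (tens : {bilinear LspaceType2 P -> L -> H2}).
Hypothesis htens : hilbert_tensor tens.
Local Notation L2 := (LspaceType2 P).
Local Notation T0 := (malliavin_monomials hPhi tens).
Local Notation S0 := (integral_monomials hPhi tens).
Local Notation C := (closure (dom T0)).

Let sT : linear_subspace (dom T0).
Proof. by apply: subspace_dom; exact: linear_span_subspace. Qed.
Let sC : linear_subspace C. Proof. exact: subspace_closure. Qed.
Let cC : closed C. Proof. exact: closed_closure. Qed.

(** On a monomial, the partial sums of the series are again combinations of monomials, and they are
    dominated by exp|Phi h| times that monomial, which is square integrable. Boundedness of [u] then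
    extends this from the polynomials to their closure. *)
Lemma multiplier_entire (a : nat -> R) (u : R -> R) M h :
  (forall i, `|a i| <= i`!%:R^-1) ->
  (forall x, \sum_(i < n) a i * x ^+ i @[n --> \oo] --> u x) ->
  (forall x, `|u x| <= M) -> multiplier C (fun x => u (Phi h x)).
Proof.
move=> ha au uM; have mPhi := measurable_Phi Phi h.
pose q n x := \sum_(i < n) a i * Phi h x ^+ i.
have mq n : measurable_fun [set: T] (q n).
  apply: measurable_sum => i; apply: measurable_funM => //.
  exact: measurable_funX.
have mu : measurable_fun [set: T] (fun x => u (Phi h x)).
  by apply: (measurable_fun_cvg mq) => x _; exact: au.
apply: (multiplier_of_dense cC (A := dom T0) (M := M)) => // F [y Fy].
have {y Fy} : dom T0 F by exists y.
pose Q := [set F : L2 | exists2 G, C G & (G : T -> R) = (fun x => u (Phi h x) * F x) %[ae P]].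
suff mQ s : Q (monomial hPhi s).
  have sQ : linear_subspace Q.
    split.
      exists 0; first exact: sC.1.
      by apply: filterS (L2_0E P) => x /(_ I) -> _; rewrite mulr0.
    move=> b F1 F2 [G1 CG1 h1] [G2 CG2 h2]; exists (b *: G1 + G2); first exact: sC.2.
    apply: filterS3 (filterI (L2_linE_ae b G1 G2) (L2_linE_ae b F1 F2)) h1 h2.
    by move=> x [/(_ I) -> /(_ I) ->] /(_ I) -> /(_ I) -> _; ring.
  by move=> [y]; apply: (linear_span_fst sQ) => _ [s ->]; exact: mQ.
have gs := growth_prodPhi Phi s; have ms := growth_measurable gs.
have mus := measurable_funM mu ms.
have [G Gu] : exists G : L2, (G : T -> R) = (fun x => u (Phi h x) * prodPhi Phi s x) %[ae P].
  apply: L2_exists; apply: (growth_Lfun hPhi).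
  apply: growth_le mus (growthM (growth_cst Phi M) gs) _ => x.
  by rewrite !normrM ler_wpM2r// (le_trans (uM _))// ler_norm.
exists G; last first.
  by apply: filterS2 Gu (monomialE hPhi s) => x /(_ I) -> /(_ I) -> _.
pose b x := `|expbound Phi [:: h] x * prodPhi Phi s x|.
apply: (@dominated_closure _ _ _ _ _ G (fun n x => q n x * prodPhi Phi s x)
  (fun x => u (Phi h x) * prodPhi Phi s x) b) => //.
- by move=> n; exact: measurable_funM.
(* The power (Phi h)^i becomes i extra entries [h] in the list. *)
- move=> n; exists (\sum_(i < n) a i *: monomial hPhi (nseq i h ++ s)).
    apply: subspace_sum => // i _; apply: subspaceZ => //.
    by exists (Dmonomial hPhi tens (nseq i h ++ s)); exact: T0_monomial.
  have e := L2_comb_ae (index_enum 'I_n) (fun i => a i)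
    (fun i : 'I_n => monomialE hPhi (nseq i h ++ s)).
  apply: filterS e => x /(_ I) -> _; rewrite /q mulr_suml; apply: eq_bigr => i _.
  by rewrite prodPhi_cat -mulrA /prodPhi big_nseq -Monoid.iteropE.
- have ge := growthM (growth_expbound Phi [:: h]) gs.
  have mb : measurable_fun [set: T] b.
    exact: measurableT_comp (@normr_measurable _ _) (growth_measurable ge).
  by apply: (growth_Lfun hPhi); apply: (growth_le mb ge) => x; rewrite /b normr_id.
- move=> n x; rewrite /b !normrM ler_wpM2r//.
  rewrite [leRHS]ger0_norm ?(ltW (expbound_gt0 _ _ _))// /expbound big_seq1.
  exact: partial_exp_le.
- by move=> x; apply: cvg_seqM; [exact: au|exact: cvg_seq_cst].
Qed.

(** For |t| <= 1 the factorial bound survives rescaling, and only the frequencies t = 1/(n+1) will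
    be used. *)
Let scaled_bound (a : nat -> R) t : `|t| <= 1 -> (forall i, `|a i| <= i`!%:R^-1) ->
  forall i, `|a i * t ^+ i| <= i`!%:R^-1.
Proof.
move=> t1 ha i; rewrite normrM normrX; apply: le_trans (ha i).
by rewrite ler_piMr// exprn_ile1.
Qed.

Lemma multiplier_sin t h : `|t| <= 1 -> multiplier C (fun x => sin (t * Phi h x)).
Proof.
move=> t1; apply: (@multiplier_entire (fun i => sin_taylor R i * t ^+ i)
  (fun y => sin (t * y)) 1).
- by apply: scaled_bound => // i; exact: norm_sin_taylor.
- move=> x; under eq_fun do under eq_bigr do rewrite -mulrA -exprMn.
  exact: cvg_sin_taylor.
- by move=> x; exact: sin_max.
Qed.

Lemma multiplier_cos t h : `|t| <= 1 -> multiplier C (fun x => cos (t * Phi h x)).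
Proof.
move=> t1; apply: (@multiplier_entire (fun i => cos_taylor R i * t ^+ i)
  (fun y => cos (t * y)) 1).
- by apply: scaled_bound => // i; exact: norm_cos_taylor.
- move=> x; under eq_fun do under eq_bigr do rewrite -mulrA -exprMn.
  exact: cvg_cos_taylor.
- by move=> x; exact: cos_max.
Qed.

(** By the addition formula sin(t (Phi h - r)) is a combination of sin(t Phi h) and cos(t Phi h)
    with constant coefficients. Its sign, for t = 1/(n+1), tends to that of Phi h - r. *)
Lemma multiplier_Phi_gt h r : multiplier C \1_(Phi h @^-1` `]r, +oo[%classic).
Proof.
rewrite (_ : _ @^-1` _ = [set x | 0 < Phi h x - r]); last first.
  by apply/seteqP; split=> x /=; rewrite in_itv/= andbT subr_gt0.
apply: multiplier_indic_gt0 => //.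
apply: (multiplier_lim cC (M := 1)
  (g_ := fun n x => Num.sg (sin (n.+1%:R^-1 * (Phi h x - r))))).
- move=> n; apply: multiplier_sg => // [|x]; last exact: sin_max.
  have n1 : `|n.+1%:R^-1 : R| <= 1.
    by rewrite ger0_norm ?invr_ge0// invf_le1 ?ltr0n// ler1n.
  under eq_fun do rewrite mulrBr sinB -mulrN.
  apply: multiplierD => //; apply: multiplierM => //; try exact: multiplier_cst.
  + exact: multiplier_sin.
  + exact: multiplier_cos.
- by move=> n x; rewrite normr_sg; case: (_ != _); rewrite ?normr1 ?normr0.
- by move=> x; exact: cvg_sg_sin.
Qed.

Lemma multiplier_Phi_preimage h (U : set R) : measurable U ->
  multiplier C \1_(Phi h @^-1` U).
Proof.
move=> mU; have : (@ocitv R).-sigma.-measurable U by exact: mU.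
rewrite RGenOInfty.measurableE; move: U {mU}; apply: smallest_sub.
  have [s0 sD sU] := sigma_algebra_multiplier sC cC.
  split=> /=; first by rewrite preimage_set0.
    by move=> A mA; rewrite setTD preimage_setC -setTD; exact: sD.
  by move=> A mA; rewrite preimage_bigcup; exact: sU.
by move=> _ [r ->] /=; exact: multiplier_Phi_gt.
Qed.

Lemma dense_dom_T0 : field_generates Phi -> dense (dom T0).
Proof.
move=> gen; apply/dense_ball => F.
suff : C F by move=> /closure_ball.
apply: (multipliers_full sC cC (one := monomial hPhi [::])).
- apply: subset_closure; exists (Dmonomial hPhi tens [::]); exact: T0_monomial.
- by apply: filterS (monomialE hPhi [::]) => x /(_ I) -> _; rewrite /prodPhi big_nil.
move=> A mA; have [B sB PAB] := gen A mA.
have mB : multiplier C \1_B.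
  move: B sB {PAB}; apply: smallest_sub; first exact: sigma_algebra_multiplier.
  by move=> _ [h [U [mU ->]]] /=; exact: multiplier_Phi_preimage.
(* Generated sets come without a measurability proof; it is read off from the indicator, which is
   measurable as a multiplier. *)
have measB : measurable B.
  have [+ _ _] := mB; move=> /(_ measurableT [set 1] (measurable_set1 _)).
  rewrite setTI (_ : _ @^-1` _ = B)//; apply/seteqP; split=> x /=.
    by rewrite indicE; case: (boolP (x \in B)) => [/set_mem//|_ /esym/eqP]; rewrite oner_eq0.
  by move=> Bx; rewrite indicE mem_set.
apply: (multiplier_ae (M := 1) mB).
- exact: measurable_indic.
- by move=> x; rewrite indicE; case: (x \in A); rewrite ?normr1 ?normr0.
exists (A `+` B); split=> //.
  by rewrite /setY; apply: measurableU; exact: measurableD.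
move=> x /= /not_implyP[_]; rewrite !indicE.
case: (boolP (x \in A)) => [/set_mem Ax|/negP NA];
  case: (boolP (x \in B)) => [/set_mem Bx|/negP NB] //= _.
- by left; split=> // /mem_set.
- by right; split=> // /mem_set.
Qed.

Lemma dom_S0_of_dom_T0 G k : dom T0 G -> dom S0 (tens G k).
Proof.
pose Q := [set G : L2 | dom S0 (tens G k)].
have sS : linear_subspace (dom S0) by apply: subspace_dom; exact: linear_span_subspace.
have sQ : linear_subspace Q.
  split; first by rewrite /Q /= linear0l; exact: sS.1.
  by move=> a x y; rewrite /Q /= linearDl linearZl; exact: sS.2.
move=> [y]; apply: (linear_span_fst sQ) => _ [s ->].
by exists (monomial hPhi (k :: s) - dmonomial hPhi k s); exact: S0_monomial.
Qed.

Lemma norm_tens f h : `|tens f h| = `|f| * `|h|.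
Proof.
apply/eqP; rewrite -(@eqrXn2 _ 2) ?mulr_ge0//.
by rewrite exprMn -!inner_norm htens.1.
Qed.

(** Elementary tensors span a dense subspace, and each f ⊗ h is approximated by F ⊗ h with F in
    [dom T0], the error being |f - F| |h|. *)
Lemma dense_dom_S0 : field_generates Phi -> dense (dom S0).
Proof.
move=> gen; have dT := dense_dom_T0 gen; apply/dense_ball => x.
suff : closure (dom S0) x by move=> /closure_ball.
have sS : linear_subspace (closure (dom S0)).
  by apply/subspace_closure/subspace_dom; exact: linear_span_subspace.
apply: closed_closure; apply/closure_ball => e e0.
have [_ /dense_ball dH] := htens; have [y ty xy] := dH x e e0; exists y => //.
apply: (linear_span_min sS) ty => _ [f _ [h _ <-]].
apply/closure_ball => r r0; have h1 : 0 < `|h| + 1 by rewrite ltr_wpDl.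
have /dense_ball/(_ f _ (divr_gt0 r0 h1))[F dF fF] := dT.
exists (tens F h); first exact: dom_S0_of_dom_T0.
rewrite -linearBl norm_tens; apply: (@le_lt_trans _ _ (`|f - F| * (`|h| + 1))).
  by rewrite ler_wpM2l// lerDl.
by rewrite -ltr_pdivlMr.
Qed.

End density.

(** * The symmetric pair *)

Theorem theorem3p13 (R : realType) (L : hilbertType R)
    (d : measure_display) (Omega : measurableType d) (P : probability Omega R)
    (Phi : L -> LspaceType2 P) (hPhi : gaussian_field Phi)
    (H2 : hilbertType R) (tens : {bilinear LspaceType2 P -> L -> H2})
    (htens : hilbert_tensor tens) :
  let T := malliavin Phi tens in
  let S := stochastic_integral Phi tens in
  [/\ is_operator T /\ is_operator S,
      forall F TF G k, T (F, TF) -> dom T G ->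
        exists2 SGk, S (tens G k, SGk) & inner TF (tens G k) = inner F SGk,
      closable T /\ closable S &
      field_generates Phi ->
        [/\ maximal_symmetric_pair T S,
            adjoint T = closure S & adjoint S = closure T]].
Proof.
move=> T S.
have sT : linear_subspace T by exact: linear_span_subspace.
have sS : linear_subspace S by exact: linear_span_subspace.
have TE : T = malliavin_monomials hPhi tens by exact: malliavin_eq.
have SE : S = integral_monomials hPhi tens by exact: stochastic_integral_eq.
have sym : formally_adjoint T S by rewrite TE SE; exact: formally_adjoint_T0_S0.
have ranT x y : T (x, y) -> dom S y by rewrite TE SE; exact: ran_T0.
have ranS x y : S (x, y) -> dom T y by rewrite TE SE; exact: ran_S0.
have clT : closable T := closable_of_formally_adjoint sT sym ranT.
have clS : closable S := closable_of_formally_adjoint sS (formally_adjointC sym) ranS.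
have opT : is_operator T := is_operator_sub_closable sT clT.
have opS : is_operator S := is_operator_sub_closable sS clS.
split=> // [F TF G k TFF dG|gen].
  have [SGk hS] : dom S (tens G k).
    by move: dG; rewrite TE SE; exact: dom_S0_of_dom_T0.
  by exists SGk => //; exact: sym TFF hS.
have dT : dense (dom T) by rewrite TE; exact: dense_dom_T0.
have dS : dense (dom S) by rewrite SE; exact: dense_dom_S0.
have [|adjT adjS] := adjoint_closure sT sS sym ranT ranS dT dS.
  by rewrite TE SE; exact: resolvent_T0_S0.
by split=> //; split=> //; split.
Qed.
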